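(* There exist a function $g\in L^1[0,1]$ and a weight function $\mu$ on $[0,1]$ with $0<\mu(x)\le 1$ such that $g$ is universal for the weighted space $L^1_\mu[0,1]$ with respect to signs of its Fourier--Walsh coefficients; that is, for every $f\in L^1_\mu[0,1]$ there exist numbers $\delta_k\in\{-1,1\}$, $k=0,1,2,\dots$, such that $$\lim_{m\to\infty}\int_0^1\left|\sum_{k=0}^m\delta_k c_k(g)W_k(x)-f(x)\right|\mu(x)\,dx=0,$$ where $c_k(g)=\int_0^1 g(x)W_k(x)\,dx$.
   Context: All functions are real-valued. A weight function is a (Lebesgue) measurable function $\mu$ on $[0,1]$ with $0<\mu(x)\le 1$. $L^1_\mu[0,1]$ is the class of measurable functions $f$ on $[0,1]$ with $\int_0^1|f(x)|\mu(x)\,dx<\infty$. The Walsh system $\{W_n\}_{n=0}^\infty$ on $[0,1]$ is defined via the Rademacher functions $R_n(x)=\operatorname{sign}(\sin 2^n\pi x)$, $x\in[0,1]$, $n=1,2,\dots$: $W_0(x)\equiv 1$, and for $n\ge 1$ with binary expansion $n=2^{k_1}+2^{k_2}+\dots+2^{k_p}$, $k_1>k_2>\dots>k_p\ge 0$, $W_n(x)=\prod_{i=1}^p R_{k_i+1}(x)$. *)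

(* Defs.v *)
From HB Require Import structures.
From mathcomp Require Import all_boot all_order all_algebra.
From mathcomp Require Import all_classical all_reals all_analysis.
From mathcomp Require Import ring zify.

Set Implicit Arguments.
Unset Strict Implicit.
Unset Printing Implicit Defensive.

Import Order.TTheory GRing.Theory Num.Theory.
Import numFieldNormedType.Exports.

Local Open Scope classical_set_scope.
Local Open Scope ring_scope.

(* The real line with the sigma-algebra of Lebesgue (Caratheodory) measurable
   sets: the canonical sigma-algebra on R itself is only the Borel one. *)
Notation leb_line R :=
  (caratheodory_type ((wlength (@idfun R))^*)%mu) (only parsing).

Notation leb R := (@completed_lebesgue_measure R) (only parsing).

(* A function on [0, 1] is represented by a total function R -> R, whose values
   outside [0, 1] are irrelevant to every notion below. *)
Definition unit_itv (R : realType) : set (leb_line R) :=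
  [set x : R | 0 <= x <= 1].
Arguments unit_itv R : clear implicits.

Definition leb_measurable_fun (R : realType) (f : R -> R) : Prop :=
  measurable_fun (unit_itv R) (f : leb_line R -> R).

Definition weight_function (R : realType) (mu : R -> R) : Prop :=
  leb_measurable_fun mu /\ forall x : R, 0 <= x <= 1 -> 0 < mu x <= 1.

Definition in_L1 (R : realType) (f : R -> R) : Prop :=
  (leb R).-integrable (unit_itv R) (fun x => (f x)%:E).

Definition in_weighted_L1 (R : realType) (mu f : R -> R) : Prop :=
  leb_measurable_fun f /\
  (\int[leb R]_(x in unit_itv R) (`|f x| * mu x)%:E < +oo)%E.

Definition rademacher (R : realType) (n : nat) (x : R) : R :=
  Num.sg (sin (2 ^+ n * pi * x)).

(* The exponents k_1, ..., k_p of the binary expansion of n: those i for which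
   the i-th binary digit is 1 (necessarily i < n, since n < 2 ^ n). *)
Definition binary_exponents (n : nat) : seq nat :=
  [seq i <- iota 0 n | odd (n %/ 2 ^ i)].

Lemma binary_expansion (n : nat) :
  n = (\sum_(i <- binary_exponents n) 2 ^ i)%N.
Proof.
have trunc m : (\sum_(0 <= i < m | odd (n %/ 2 ^ i)) 2 ^ i = n %% 2 ^ m)%N.
  elim: m => [|m IHm]; first by rewrite big_geq // modn1.
  rewrite big_mkcond big_nat_recr //= -big_mkcond IHm.
  set q := (n %/ 2 ^ m)%N; set r := (n %% 2 ^ m)%N.
  have lt_r : (r < 2 ^ m)%N by rewrite ltn_pmod ?expn_gt0.
  have -> : n = (q./2 * 2 ^ m.+1 + (odd q * 2 ^ m + r))%N.
    rewrite {1}(divn_eq n (2 ^ m)) -/q -/r -{1}(odd_double_half q) -muln2.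
    by rewrite expnS; ring.
  rewrite modnMDl modn_small; first by case: odd; rewrite ?mul1n ?mul0n addnC.
  by rewrite expnS; case: odd; lia.
rewrite big_filter -[in iota 0 n](subn0 n) -/(index_iota 0 n) trunc.
by rewrite modn_small // ltn_expl.
Qed.

Definition walsh (R : realType) (n : nat) (x : R) : R :=
  \prod_(i <- binary_exponents n) rademacher i.+1 x.

Definition walsh_coef (R : realType) (g : R -> R) (k : nat) : R :=
  (\int[leb R]_(x in unit_itv R) (g x * walsh k x))%R.

(* The integrals are taken in the extended reals, where they are always
   defined, so that the convergence to 0 entails their eventual finiteness. *)
Definition universal_wrt_signs (R : realType) (mu g : R -> R) : Prop :=
  forall f : R -> R, in_weighted_L1 mu f ->
    exists delta : nat -> R,
      (forall k, delta k = -1 \/ delta k = 1) /\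
      (\int[leb R]_(x in unit_itv R)
        (`|\sum_(0 <= k < m.+1) delta k * walsh_coef g k * walsh k x - f x|
         * mu x)%:E)%E @[m --> \oo] --> 0%E.

(* Main.v *)
Require Import Defs.
From mathcomp Require Import all_boot all_order all_algebra.
From mathcomp Require Import all_classical all_reals all_analysis.
From mathcomp Require Import measurable_realfun.
From mathcomp Require Import ring lra zify.

(* Given a dyadic step function [P], there are two Walsh polynomials with coefficients
   equal up to sign: one of arbitrarily small L1 norm, the other equal to [P] times a
   unimodular function of mean 0. The former polynomials build up [g]; flipping signs
   turns them into the latter, which are fair bets. Doubling the stake of lost bets
   yields, at stage [s], the increment [+-1/(s+1)] outside a set [B_s] of measure
   [2^-s], the sign being free on each dyadic interval of the current rank. Since almost
   every point lies in finitely many [B_s], a weight small on the [B_s] makes the losses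
   negligible; and since the increments tend to 0 while their sum diverges, always
   stepping towards slowly varying step approximations of [f] makes the partial sums
   converge to [f], almost everywhere and then in the weighted L1 by domination. *)

Set Implicit Arguments.
Unset Strict Implicit.
Unset Printing Implicit Defensive.

Import Order.TTheory GRing.Theory Num.Theory.
Import numFieldNormedType.Exports.

Local Open Scope classical_set_scope.
Local Open Scope ring_scope.

(** * Dyadic step functions and Walsh polynomials *)

Section Bits.
Context {R : realType}.
Implicit Types (F G P : R -> R) (x : R) (N M k : nat).

(** A weight cannot be avoided: convergence in the unweighted L1 would force delta_k c_k(g) = c_k(f)
    for every f at once. The order of the quantifiers shapes the rest: [g] and the weight are fixed
    before [f], so a stage has to offer every pattern of signs with the same absolute values of
    coefficients and the same exceptional set. The frequencies of a stage are at least 2^n, where n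
    is the current rank, so its polynomial is orthogonal to all step functions of rank n. An
    increment +-1/(s+1) on most of a dyadic interval must therefore be paid for on the rest of it;
    this is why the increment has the form +-(1 - 2^s b)/(s+1) with b the indicator of a set of
    measure 2^-s. The loss has mean 1/(s+1), and these means have an infinite sum: no estimate in
    mean can absorb the losses, only a weight that is small pointwise. Two scales coexist: 2^-s
    bounds the L1 norm of the small polynomial and makes [g] integrable, while 1/(s+1) is the size
    of the moves and also controls the partial sums cut inside a stage. *)

Definition bit N x : bool := odd (Num.truncn (2 ^+ N * x)).

Fixpoint bits N x : seq bool :=
  if N is N'.+1 then rcons (bits N' x) (bit N x) else [::].

Definition rad N x : R := (-1) ^+ bit N x.

(* Constant on the dyadic intervals of length 2^-N, periodically extended. *)
Definition step N F : Prop := exists h : seq bool -> R, forall x, F x = h (bits N x).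

Lemma size_bits N x : size (bits N x) = N.
Proof. by elim: N => //= N IH; rewrite size_rcons IH. Qed.

Lemma take_bits N M x : (N <= M)%N -> take N (bits M x) = bits N x.
Proof.
elim: M => [|M IH]; first by rewrite leqn0 => /eqP ->.
rewrite leq_eqVlt => /predU1P[->|]; first by rewrite take_oversize ?size_bits.
by rewrite ltnS => NM /=; rewrite -cats1 takel_cat ?size_bits// IH.
Qed.

Lemma step_le N M F : (N <= M)%N -> step N F -> step M F.
Proof. by move=> NM [h hF]; exists (h \o take N) => x /=; rewrite take_bits. Qed.

Lemma step_cst N (a : R) : step N (fun=> a).
Proof. by exists (fun=> a). Qed.

Lemma step_comp N (f : R -> R) F : step N F -> step N (fun x => f (F x)).
Proof. by move=> [h hF]; exists (f \o h) => x; rewrite hF. Qed.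

Lemma step_comp2 N (f : R -> R -> R) F G : step N F -> step N G ->
  step N (fun x => f (F x) (G x)).
Proof. by move=> [h hF] [k kG]; exists (fun s => f (h s) (k s)) => x; rewrite hF kG. Qed.

Lemma stepD N F G : step N F -> step N G -> step N (fun x => F x + G x).
Proof. exact: (@step_comp2 N +%R). Qed.

Lemma stepM N F G : step N F -> step N G -> step N (fun x => F x * G x).
Proof. exact: (@step_comp2 N *%R). Qed.

Lemma stepZ N (a : R) F : step N F -> step N (fun x => a * F x).
Proof. exact: (@step_comp N (fun y => a * y)). Qed.

Lemma stepN N F : step N F -> step N (fun x => - F x).
Proof. exact: (@step_comp N -%R). Qed.

Lemma stepB N F G : step N F -> step N G -> step N (fun x => F x - G x).
Proof. exact: (@step_comp2 N (fun a b => a - b)). Qed.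

Lemma step_abs N F : step N F -> step N (fun x => `|F x|).
Proof. exact: (@step_comp N Num.norm). Qed.

Lemma step_rad N M : (0 < N <= M)%N -> step M (rad N).
Proof.
case: N => // N /= NM; apply: (step_le NM).
by exists (fun s => (-1) ^+ last false s) => x /=; rewrite last_rcons.
Qed.

Lemma rad_sq N x : rad N x * rad N x = 1.
Proof. by rewrite /rad -expr2 sqrr_sign. Qed.

Lemma abs_rad N x : `|rad N x| = 1.
Proof. by rewrite /rad normr_sign. Qed.

Lemma rad_cases N x : rad N x = 1 \/ rad N x = -1.
Proof. by rewrite /rad; case: bit; rewrite ?expr0 ?expr1; [right|left]. Qed.

(* Equals [walsh k] off the dyadic rationals, where [rademacher] vanishes. *)
Definition wal k x : R := \prod_(i <- binary_exponents k) rad i.+1 x.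

Lemma walE N k x : (k < 2 ^ N)%N ->
  wal k x = \prod_(0 <= i < N | odd (k %/ 2 ^ i)) rad i.+1 x.
Proof.
move=> kN; rewrite /wal /binary_exponents big_filter.
(* The ranges of length [k] and [N] are compared through their maximum, since the digits of [k]
   beyond either range vanish. *)
have ext n : (k < 2 ^ n)%N -> \prod_(0 <= i < n | odd (k %/ 2 ^ i)) rad i.+1 x =
    \prod_(0 <= i < maxn k N | odd (k %/ 2 ^ i)) rad i.+1 x.
  move=> kn; have [nm|mn] := leqP n (maxn k N).
    rewrite [RHS](@big_cat_nat _ _ _ n)//= [X in _ * X]big1_seq ?mulr1// => i.
    rewrite mem_index_iota => /andP[/[swap]] /andP[ni _].
    by rewrite divn_small// (leq_trans kn)// leq_exp2l.
  rewrite [LHS](@big_cat_nat _ _ _ (maxn k N))//=; last exact: ltnW.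
  rewrite [X in _ * X]big1_seq ?mulr1// => i.
  rewrite mem_index_iota => /andP[/[swap]] /andP[ni _].
  by rewrite divn_small// (leq_trans kN)// leq_exp2l// (leq_trans _ ni)// leq_maxr.
rewrite -[in iota 0 k](subn0 k) -/(index_iota 0 k); exact: etrans (ext k (ltn_expl k (ltnSn 1))) (esym (ext N kN)).
Qed.

Lemma wal0 x : wal 0 x = 1.
Proof. by rewrite /wal /= big_nil. Qed.

Lemma wal_lo N k x : (k < 2 ^ N)%N -> wal (2 ^ N + k) x = rad N.+1 x * wal k x.
Proof.
move=> kN; rewrite (@walE N.+1); last by rewrite expnS mul2n -addnn ltn_add2l.
rewrite big_mkcond big_nat_recr//= divnDl ?dvdnn// divnn expn_gt0/= divn_small//=.
rewrite mulrC (walE _ kN) [in RHS]big_mkcond; congr (_ * _).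
apply: eq_big_nat => i /andP[_ iN].
rewrite divnDl ?dvdn_exp2l// 1?ltnW// oddD -expnB// 1?ltnW//.
by rewrite oddX subn_eq0 leqNgt iN.
Qed.

Lemma abs_wal k x : `|wal k x| = 1.
Proof.
rewrite /wal normr_prod big1// => i _; exact: abs_rad.
Qed.

Lemma step_wal N k : (k < 2 ^ N)%N -> step N (wal k).
Proof.
elim: N k => [|N IH] k.
  by rewrite expn0 ltnS leqn0 => /eqP ->; exists (fun=> 1) => x; rewrite wal0.
rewrite expnS mul2n -addnn => kN; have [kl|kl] := ltnP k (2 ^ N).
  exact: step_le (IH _ kl).
rewrite -(subnKC kl); have k2 : (k - 2 ^ N < 2 ^ N)%N by rewrite ltn_subLR.
have [h hE] := stepM (step_rad (N := N.+1) (leqnn _)) (step_le (leqnSn N) (IH _ k2)).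
by exists h => x; rewrite wal_lo.
Qed.

Definition wsum (c : nat -> R) m x : R := \sum_(0 <= k < m) c k * wal k x.

Lemma step_wsum c m N : (m <= 2 ^ N)%N -> step N (wsum c m).
Proof.
elim: m => [|m IH] mN; first by exists (fun=> 0) => x; rewrite /wsum big_geq.
have [h hE] := stepD (IH (ltnW mN)) (stepZ (c m) (step_wal mN)).
by exists h => x; rewrite -hE /wsum big_nat_recr.
Qed.

Lemma wsum_add (c d : nat -> R) m x :
  wsum (fun k => c k + d k) m x = wsum c m x + wsum d m x.
Proof. by rewrite /wsum -big_split; apply: eq_bigr => i _; rewrite mulrDl. Qed.

Lemma wsumZ (a : R) (c : nat -> R) m x : wsum (fun k => a * c k) m x = a * wsum c m x.
Proof. by rewrite /wsum mulr_sumr; apply: eq_bigr => i _; rewrite mulrA. Qed.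

Lemma eq_wsum (c d : nat -> R) m x : (forall k, (k < m)%N -> c k = d k) ->
  wsum c m x = wsum d m x.
Proof. by move=> cd; apply: eq_big_nat => k /andP[_ km]; rewrite cd. Qed.

Lemma wsum_cat c m n x : (m <= n)%N ->
  wsum c n x = wsum c m x + \sum_(m <= k < n) c k * wal k x.
Proof. by move=> mn; rewrite /wsum (@big_cat_nat _ _ _ m). Qed.

Lemma wsum_stable c m n x : (m <= n)%N -> (forall k, (m <= k < n)%N -> c k = 0) ->
  wsum c n x = wsum c m x.
Proof.
move=> mn c0; rewrite (wsum_cat _ _ mn) big1_seq ?addr0// => k.
by rewrite mem_index_iota => kk; rewrite c0// mul0r.
Qed.

Lemma wsum0 c m x : (forall k, (k < m)%N -> c k = 0) -> wsum c m x = 0.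
Proof. by move=> c0; rewrite (@wsum_stable c 0)// /wsum big_geq. Qed.

Lemma wsum_shift c N m x : (m <= 2 ^ N)%N ->
  \sum_(2 ^ N <= k < 2 ^ N + m) c k * wal k x =
  rad N.+1 x * wsum (fun k => c (2 ^ N + k)%N) m x.
Proof.
move=> mN; rewrite -{1}[(2 ^ N)%N]add0n [in X in index_iota _ X]addnC big_addn.
rewrite addnK mulr_sumr; apply: eq_big_nat => k /andP[_ km].
by rewrite [(k + _)%N]addnC wal_lo ?(leq_trans km)//; ring.
Qed.

(** Induction on the last binary digit: the half-sum over its two values takes the frequencies below
    [2 ^ N], the half-difference, carried by [rad N.+1], takes the next [2 ^ N]. *)
Lemma step_wsumP N F : step N F -> exists c, forall x, F x = wsum c (2 ^ N) x.
Proof.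
elim: N F => [|N IH] F [h hF].
  by exists (fun=> h [::]) => x; rewrite /wsum big_nat1 wal0 mulr1 hF.
have [|c cE] := IH (fun x => (h (rcons (bits N x) false) + h (rcons (bits N x) true)) / 2).
  by exists (fun s => (h (rcons s false) + h (rcons s true)) / 2).
have [|d dE] := IH (fun x => (h (rcons (bits N x) false) - h (rcons (bits N x) true)) / 2).
  by exists (fun s => (h (rcons s false) - h (rcons s true)) / 2).
exists (fun k => if (k < 2 ^ N)%N then c k else d (k - 2 ^ N)%N) => x.
rewrite expnS mul2n -addnn (@wsum_cat _ (2 ^ N)) ?leq_addr// wsum_shift//.
rewrite (@eq_wsum _ c) -?cE; last by move=> k ->.
rewrite (@eq_wsum _ d) -?dE; last by move=> k _; rewrite addKn ltnNge leq_addr.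
by rewrite hF /= /rad; case: bit; rewrite ?expr0 ?expr1; field.
Qed.

End Bits.

(** * Integrals of dyadic step functions *)

Section StepIntegral.
Context {R : realType}.
Implicit Types (F G P : R -> R) (x y : R) (N M k j : nat).

Notation mu := (leb R).
Notation U := (unit_itv R).

Lemma unit_itvE : U = [set` `[0, 1]] :> set R.
Proof. by apply/seteqP; split => x /=; rewrite in_itv. Qed.

Lemma measurable_leb_line (A : set R) :
  measurable (A : set (measurableTypeR R)) -> measurable (A : set (leb_line R)).
Proof. exact: sub_caratheodory. Qed.

Lemma measurable_unit_itv : measurable U.
Proof.
by rewrite unit_itvE; apply: measurable_leb_line; exact: measurable_itv.
Qed.
#[local] Hint Resolve measurable_unit_itv : core.

Lemma leb_itv (i : interval R) :
  mu [set` i] = (if (i.1 < i.2)%E then (i.2 : \bar R) - i.1 else 0)%E.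
Proof. exact: lebesgue_measure_itv. Qed.

Lemma leb_unit_itv : mu U = 1%E.
Proof. by rewrite unit_itvE leb_itv /= lte01 oppr0 adde0. Qed.

Definition dyadic M j : set (leb_line R) :=
  [set` `[j%:R / 2 ^+ M, j.+1%:R / 2 ^+ M[] `&` U.

Lemma measurable_dyadic M j : measurable (dyadic M j).
Proof.
by apply: measurableI => //; apply: measurable_leb_line; exact: measurable_itv.
Qed.

Lemma in_dyadic M j x : U x -> dyadic M j x <-> Num.truncn (2 ^+ M * x) = j.
Proof.
move=> Ux; have x0 : 0 <= 2 ^+ M * x by case/andP: Ux => ? _; rewrite mulr_ge0.
have p0 : 0 < (2 ^+ M : R) by rewrite exprn_gt0.
split=> [[/= + _]|/eqP].
  rewrite in_itv/= ler_pdivrMr// ltr_pdivlMr// ![x * _]mulrC => h.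
  exact: truncn_def.
by rewrite truncn_eq// => h; split=> //=; rewrite in_itv/= ler_pdivrMr// ltr_pdivlMr// ![x * _]mulrC.
Qed.

Lemma leb_dyadic M j : mu (dyadic M j) = (if (j < 2 ^ M)%N then (2 ^- M)%:E else 0)%E.
Proof.
have p0 : 0 < (2 ^+ M : R) by rewrite exprn_gt0.
case: ifPn => jM.
  have -> : dyadic M j = [set` `[j%:R / 2 ^+ M, j.+1%:R / 2 ^+ M[] :> set R.
    apply/seteqP; split=> [x []//|x/= jx]; split=> //.
    move: jx; rewrite /unit_itv/= in_itv/= => /andP[h1 h2]; apply/andP; split.
      by apply: le_trans h1; rewrite divr_ge0// ltW.
    apply/ltW/(lt_le_trans h2); rewrite ler_pdivrMr// mul1r -natrX ler_nat.
    exact: jM.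
  rewrite leb_itv/= lte_fin ltr_pM2r ?invr_gt0// ltr_nat ltnSn.
  by rewrite -EFinD -mulrBl -natrB// subSnn mul1r.
(* For [2 ^ M <= j] the cell meets [0, 1] at most in the point 1. *)
apply: (@subset_measure0 _ (leb_line R) R mu _ [set` `[1, 1]]).
- exact: measurable_dyadic.
- by apply: measurable_leb_line; exact: measurable_itv.
- move=> x [/= ]; rewrite /unit_itv/= !in_itv/= => /andP[h1 h2] /andP[h3 ->].
  rewrite andbT; apply: le_trans h1; rewrite ler_pdivlMr// mul1r -natrX ler_nat.
  by rewrite leqNgt.
- by apply: etrans (leb_itv _) _; rewrite /= ltxx.
Qed.

Lemma truncn_half x N : Num.truncn (2 ^+ N * x) = (Num.truncn (2 ^+ N.+1 * x))./2.
Proof.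
have [x0|x0] := leP 0 x; last first.
  have t0 n : Num.truncn (2 ^+ n * x) = 0%N.
    apply/eqP; rewrite -leqn0 truncn_le_nat.
    by apply: (lt_trans _ ltr01); rewrite pmulr_rlt0 ?exprn_gt0.
  by rewrite !t0.
have h : 0 <= 2 ^+ N.+1 * x by rewrite mulr_ge0.
have := truncn_itv h; set t := Num.truncn _ => /andP[t1 t2].
apply: truncn_def; move: t1 t2; rewrite exprS -mulrA.
set y := 2 ^+ N * x; have tE : t%:R = (odd t)%:R + 2 * (t./2)%:R :> R.
  by rewrite -{1}(odd_double_half t) natrD -mul2n natrM.
rewrite -!natr1 tE; case: (odd t); rewrite ?mulr1n ?mulr0n /= => t1 t2; apply/andP; split; lra.
Qed.

Lemma truncn_bits x y M : Num.truncn (2 ^+ M * x) = Num.truncn (2 ^+ M * y) ->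
  bits M x = bits M y.
Proof.
elim: M => [//|M IH] e.
have b : bit M.+1 x = bit M.+1 y := congr1 odd e.
by rewrite [LHS]/= [RHS]/= b IH// truncn_half [RHS]truncn_half e.
Qed.

Lemma step_truncn F x y M : step M F ->
  Num.truncn (2 ^+ M * x) = Num.truncn (2 ^+ M * y) -> F x = F y.
Proof. by move=> [h hF] /truncn_bits e; rewrite !hF e. Qed.

(** The cells are half-open, so the additional index [2 ^ M] is there for the point 1; its cell is
    null and disappears in [integral_step]. *)
Lemma step_dyadicE M F x : step M F -> U x ->
  F x = \sum_(0 <= j < (2 ^ M).+1) F (j%:R / 2 ^+ M) * \1_(dyadic M j) x.
Proof.
move=> sF Ux; have p0 : 0 < (2 ^+ M : R) by rewrite exprn_gt0.
have x0 : 0 <= 2 ^+ M * x by case/andP: Ux => ? _; rewrite mulr_ge0.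
set t := Num.truncn (2 ^+ M * x).
have tM : (t < (2 ^ M).+1)%N.
  rewrite truncn_lt_nat//; case/andP: Ux => _ x1.
  by rewrite -[ltRHS]natr1 natrX ltr_pwDr// ger_pMr.
rewrite (bigD1_seq t) ?iota_uniq ?mem_index_iota//= big1_seq ?addr0.
  rewrite indicE mem_set ?mulr1; last by apply/in_dyadic.
  by apply: (step_truncn sF); rewrite mulrCA divff ?gt_eqF// mulr1 natrK.
move=> j /andP[jt _]; rewrite indicE memNset ?mulr0// => /in_dyadic-/(_ Ux) e.
by rewrite -e eqxx in jt.
Qed.

Lemma integrable_dyadic M j : mu.-integrable U (fun x => (\1_(dyadic M j) x)%:E).
Proof.
apply/integrableP; split.
  apply/measurable_EFinP; apply: measurable_funS (measurable_indic _) => //.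
  exact: measurable_dyadic.
under eq_integral do rewrite abse_EFin ger0_norm//.
rewrite integral_indic//; last exact: measurable_dyadic.
rewrite setIidl; last by move=> x [].
rewrite [X in (X < _)%E](_ : _ = mu (dyadic M j))// leb_dyadic.
by case: ifP => _; exact: ltry.
Qed.

Lemma integrable_step M F : step M F -> mu.-integrable U (fun x => (F x)%:E).
Proof.
move=> sF.
apply: (@eq_integrable _ _ _ mu _ measurable_unit_itv (fun x : leb_line R => \sum_(0 <= j < (2 ^ M).+1)
    (F (j%:R / 2 ^+ M))%:E * (\1_(dyadic M j) x)%:E)%E).
  move=> x; rewrite inE => Ux; rewrite (step_dyadicE sF Ux) -sumEFin.
  by apply: eq_bigr => j _; rewrite EFinM.
apply: integrable_sum => // j _; apply: integrableZl => //.
exact: integrable_dyadic.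
Qed.

Lemma integral_step M F : step M F ->
  (\int[mu]_(x in U) F x)%R = 2 ^- M * \sum_(0 <= j < 2 ^ M) F (j%:R / 2 ^+ M).
Proof.
move=> sF; rewrite /Rintegral.
rewrite (eq_integral (fun x : leb_line R => \sum_(0 <= j < (2 ^ M).+1)
    (F (j%:R / 2 ^+ M))%:E * (\1_(dyadic M j) x)%:E)%E); last first.
  move=> x; rewrite inE => Ux; rewrite (step_dyadicE sF Ux) -sumEFin.
  by apply: eq_bigr => j _; rewrite EFinM.
rewrite integral_sum//; last first.
  by move=> j; apply: integrableZl => //; exact: integrable_dyadic.
rewrite (eq_bigr (fun j => (F (j%:R / 2 ^+ M) * (if (j < 2 ^ M)%N then 2 ^- M else 0))%:E)).
  rewrite sumEFin/= big_nat_recr//= ltnn mulr0 addr0 mulr_sumr.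
  by apply: eq_big_nat => j /andP[_ ->]; rewrite mulrC.
move=> j _; rewrite integralZl//; last exact: integrable_dyadic.
rewrite integral_indic//; last exact: measurable_dyadic.
rewrite setIidl; last by move=> x [].
rewrite [X in (_ * X)%E](_ : _ = mu (dyadic M j))// leb_dyadic.
by case: ifP => _; rewrite EFinM.
Qed.

End StepIntegral.

(** * Means and orthogonality of the Walsh functions *)

Section StepMean.
Context {R : realType}.
Implicit Types (F G P : R -> R) (x y : R) (N M k j : nat).

Definition mean F : R := (\int[leb R]_(x in unit_itv R) F x)%R.

Lemma eq_mean F G : F =1 G -> mean F = mean G.
Proof. by move=> /funext ->. Qed.

Lemma mean_cst (a : R) : mean (fun=> a) = a.
Proof.
rewrite /mean (@integral_step _ 0 (fun=> a)); last exact: step_cst.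
by rewrite expr0 invr1 mul1r big_nat1.
Qed.

Lemma meanD N F G : step N F -> step N G -> mean (fun x => F x + G x) = mean F + mean G.
Proof.
move=> sF sG; rewrite /mean RintegralD//; first exact: measurable_unit_itv.
- exact: integrable_step sF.
- exact: integrable_step sG.
Qed.

Lemma meanZ N a F : step N F -> mean (fun x => a * F x) = a * mean F.
Proof.
move=> sF; rewrite /mean RintegralZl//; first exact: measurable_unit_itv.
exact: integrable_step sF.
Qed.

Lemma meanN N F : step N F -> mean (fun x => - F x) = - mean F.
Proof.
move=> sF; rewrite -mulN1r -(meanZ _ sF).
by apply: eq_mean => x; rewrite mulN1r.
Qed.

Lemma meanB N F G : step N F -> step N G -> mean (fun x => F x - G x) = mean F - mean G.
Proof. by move=> sF sG; rewrite (meanD sF (stepN sG)) (meanN sG). Qed.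

Lemma le_mean N F G : step N F -> step N G -> (forall x, F x <= G x) ->
  mean F <= mean G.
Proof.
move=> sF sG FG; apply: le_Rintegral => //; first exact: measurable_unit_itv.
- exact: integrable_step sF.
- exact: integrable_step sG.
Qed.

Lemma mean_ge0 F : (forall x, 0 <= F x) -> 0 <= mean F.
Proof. by move=> F0; apply: Rintegral_ge0 => x _. Qed.

(** The cells [2j] and [2j + 1] of rank [N.+1] cancel: they have the same first [N] digits, hence
    the same value of [F], and opposite values of [rad N.+1]. *)
Lemma mean_rad N F : step N F -> mean (fun x => F x * rad N.+1 x) = 0.
Proof.
move=> sF; rewrite /mean (@integral_step _ N.+1); last first.
  by apply: stepM; [exact: step_le sF|apply: step_rad; rewrite leqnn].
suff S n : \sum_(0 <= j < n.*2) F (j%:R / 2 ^+ N.+1) * rad N.+1 (j%:R / 2 ^+ N.+1) = 0.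
  by rewrite expnS mul2n S mulr0.
elim: n => [|n IH]; first by rewrite big_geq.
rewrite doubleS !big_nat_recr//= IH add0r.
have p0 : (2 ^+ N.+1 : R) != 0 by rewrite expf_neq0.
have tr j : Num.truncn (2 ^+ N.+1 * (j%:R / 2 ^+ N.+1) : R) = j.
  by rewrite mulrCA divff// mulr1 natrK.
rewrite /rad /bit !tr /= odd_double /= expr0 expr1.
rewrite (@step_truncn _ _ ((n.*2)%:R / 2 ^+ N.+1) ((n.*2.+1)%:R / 2 ^+ N.+1) _ sF).
  by rewrite mulr1 mulrN1 subrr.
by rewrite truncn_half [RHS]truncn_half !tr /= uphalf_double doubleK.
Qed.

Lemma wal_split N k x : (k < 2 ^ N.+1)%N ->
  wal k x = (if (2 ^ N <= k)%N then rad N.+1 x else 1) * wal (k %% 2 ^ N)%N x :> R.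
Proof.
move=> kN; case: ifPn => [Nk|]; last first.
  by rewrite -ltnNge => k2; rewrite modn_small// mul1r.
have k2 : (k - 2 ^ N < 2 ^ N)%N by move: kN; rewrite expnS; lia.
by rewrite -{1 2}(subnKC Nk) modnDl modn_small// wal_lo.
Qed.

(** Induction on the highest digit: if both indices have it, its two factors cancel by [rad_sq]; if
    only one has it, [mean_rad] applies. *)
Lemma mean_wal N j k : (j < 2 ^ N)%N -> (k < 2 ^ N)%N ->
  mean (fun x => wal j x * wal k x) = (j == k)%:R.
Proof.
elim: N j k => [|N IH] j k jN kN.
  move: jN kN; rewrite expn0 !ltnS !leqn0 => /eqP -> /eqP ->.
  by rewrite (@eq_mean _ (fun=> 1)) ?mean_cst// => x; rewrite wal0 mulr1.
have mN i : (i %% 2 ^ N < 2 ^ N)%N by rewrite ltn_mod expn_gt0.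
have IHm := IH _ _ (mN j) (mN k).
have sjk : step N (fun x : R => wal (j %% 2 ^ N) x * wal (k %% 2 ^ N) x).
  by apply: stepM; exact: step_wal.
have [js|js] := leqP (2 ^ N) j; have [ks|ks] := leqP (2 ^ N) k.
- rewrite (@eq_mean _ (fun x => wal (j %% 2 ^ N) x * wal (k %% 2 ^ N) x)).
    rewrite IHm; have -> // : (j %% 2 ^ N == k %% 2 ^ N)%N = (j == k).
    rewrite -(subnKC js) -(subnKC ks) !modnDl eqn_add2l !modn_small//.
      by move: kN; rewrite expnS; lia.
    by move: jN; rewrite expnS; lia.
  by move=> x; rewrite (wal_split _ jN) (wal_split _ kN) js ks mulrACA rad_sq mul1r.
- rewrite (@eq_mean _ (fun x => wal (j %% 2 ^ N) x * wal (k %% 2 ^ N) x * rad N.+1 x)).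
    by rewrite mean_rad//; have /negPf -> : j != k by lia.
  move=> x; rewrite (wal_split _ jN) (wal_split _ kN) js leqNgt ks mul1r.
  by rewrite -mulrA mulrC.
- rewrite (@eq_mean _ (fun x => wal (j %% 2 ^ N) x * wal (k %% 2 ^ N) x * rad N.+1 x)).
    by rewrite mean_rad//; have /negPf -> : j != k by lia.
  move=> x; rewrite (wal_split _ jN) (wal_split _ kN) ks leqNgt js mul1r.
  by rewrite mulrCA mulrC.
- rewrite (@eq_mean _ (fun x => wal (j %% 2 ^ N) x * wal (k %% 2 ^ N) x)).
    by rewrite IHm !modn_small.
  by move=> x; rewrite !modn_small.
Qed.

Lemma mean_wsum c m j : mean (fun x => wsum c m x * wal j x) = if (j < m)%N then c j else 0.
Proof.
elim: m => [|m IH].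
  by rewrite (@eq_mean _ (fun=> 0)) ?mean_cst// => x; rewrite /wsum big_geq ?mul0r.
pose N := maxn m.+1 j.
have lt2 i : (i <= N)%N -> (i < 2 ^ N)%N.
  by move=> iN; exact: leq_ltn_trans iN (ltn_expl _ _).
have mN : (m < 2 ^ N)%N by apply: lt2; rewrite /N; lia.
have jN : (j < 2 ^ N)%N by apply: lt2; rewrite /N; lia.
rewrite (@eq_mean _ (fun x => wsum c m x * wal j x + c m * (wal m x * wal j x))); last first.
  by move=> x; rewrite /wsum big_nat_recr//= mulrDl -mulrA.
have sw : step N (fun x : R => wal m x * wal j x) by apply: stepM; exact: step_wal.
have sc : step N (fun x : R => wsum c m x * wal j x).
  by apply: stepM; [apply: step_wsum; exact: ltnW|exact: step_wal].
rewrite (meanD sc (stepZ _ sw)) IH (meanZ _ sw) (mean_wal mN jN).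
rewrite ltnS [(j <= m)%N]leq_eqVlt [m == j]eq_sym; case: eqP => [->|_] /=.
  by rewrite ltnn mulr1 add0r.
by rewrite mulr0 addr0.
Qed.

End StepMean.

(** * Blocks of coefficients and the elementary fair bet *)

Section Blocks.
Context {R : realType}.
Implicit Types (F G P : R -> R) (x y : R) (N M k j m : nat) (c d u v : nat -> R).

(** Concatenation of two coefficient sequences of length [2 ^ M]. On polynomials it is
    [u + rad M.+1 * v], as in the recursion of Rudin and Shapiro. *)
Definition dbl M u v k : R :=
  if (k < 2 ^ M)%N then u k else if (k < 2 ^ M.+1)%N then v (k - 2 ^ M)%N else 0.

Lemma dbl_lo M u v m x : (m <= 2 ^ M)%N -> wsum (dbl M u v) m x = wsum u m x.
Proof. by move=> mM; apply: eq_wsum => k km; rewrite /dbl (leq_trans km mM). Qed.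

Lemma dbl_hi M u v m x : (m <= 2 ^ M)%N ->
  wsum (dbl M u v) (2 ^ M + m) x = wsum u (2 ^ M) x + rad M.+1 x * wsum v m x.
Proof.
move=> mM; rewrite (@wsum_cat _ _ (2 ^ M)) ?leq_addr// dbl_lo// wsum_shift//.
congr (_ + _ * _); apply: eq_wsum => k km.
rewrite /dbl ltnNge leq_addr/= expnS mul2n -addnn ltn_add2l addKn.
by rewrite (leq_trans km mM).
Qed.

Lemma dbl_full M u v x :
  wsum (dbl M u v) (2 ^ M.+1) x = wsum u (2 ^ M) x + rad M.+1 x * wsum v (2 ^ M) x.
Proof. by rewrite expnS mul2n -addnn dbl_hi. Qed.

Lemma dbl_partial M u v m x : exists m',
  wsum (dbl M u v) m x = wsum u m' x \/
  wsum (dbl M u v) m x = wsum u (2 ^ M) x + rad M.+1 x * wsum v m' x.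
Proof.
have [mM|mM] := leqP m (2 ^ M); first by exists m; left; rewrite dbl_lo.
have [mS|mS] := leqP m (2 ^ M.+1).
  exists (m - 2 ^ M)%N; right; rewrite -{1}(subnKC (ltnW mM)) dbl_hi//.
  by move: mS; rewrite expnS; lia.
exists (2 ^ M)%N; right; rewrite -dbl_full; apply: wsum_stable; first exact: ltnW.
move=> k /andP[Mk _]; rewrite /dbl !ltnNge Mk /= (leq_trans _ Mk)//.
by rewrite leq_exp2l.
Qed.

Lemma dbl_norm M u v u' v' k : (forall j, `|u j| = `|u' j|) ->
  (forall j, `|v j| = `|v' j|) -> `|dbl M u v k| = `|dbl M u' v' k|.
Proof. by move=> uu vv; rewrite /dbl; case: ifP => // _; case: ifP. Qed.

(** Equality of absolute values, rather than explicit signs, is what passes to sums of disjoint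
    blocks; the signs are read off only at the end, in [total_sign]. *)
Definition block N M c d : Prop :=
  [/\ (N <= M)%N, forall k, (k < 2 ^ N)%N || (2 ^ M <= k)%N -> c k = 0 &
      forall k, `|d k| = `|c k|].

Lemma block_d0 N M c d k : block N M c d -> (k < 2 ^ N)%N || (2 ^ M <= k)%N -> d k = 0.
Proof.
by move=> [_ c0 dc] /c0 ck; apply/eqP; rewrite -normr_eq0 dc ck normr0.
Qed.

Lemma block_c N M c d : block N M c d -> block N M c c.
Proof. by case. Qed.

Lemma block_sum N M c d m x : block N M c d -> (2 ^ M <= m)%N ->
  wsum d m x = wsum d (2 ^ M) x.
Proof.
move=> B Mm; apply: wsum_stable => // k /andP[Mk _].
by rewrite (block_d0 B)// Mk orbT.
Qed.

Lemma block_sum0 N M c d m x : block N M c d -> (m <= 2 ^ N)%N -> wsum d m x = 0.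
Proof.
move=> B mN; apply: wsum0 => k km; rewrite (block_d0 B)//.
by rewrite (leq_trans km mN).
Qed.

Lemma block_join N M L c d c' d' : block N M c d -> block M L c' d' ->
  block N L (fun k => c k + c' k) (fun k => d k + d' k).
Proof.
move=> B B'; case: (B) => NM c0 dc; case: (B') => ML c0' dc'; split.
- exact: leq_trans ML.
- move=> k /orP[kN|Lk].
    rewrite c0 ?kN// c0' ?add0r//.
    by rewrite (leq_trans kN)// leq_exp2l.
  rewrite c0' ?Lk ?orbT// c0 ?addr0//.
  by rewrite (leq_trans _ Lk) ?orbT// leq_exp2l.
- move=> k; have [kM|kM] := ltnP k (2 ^ M).
    by rewrite c0' ?kM// (block_d0 B') ?kM// !addr0.
  by rewrite c0 ?kM ?orbT// (block_d0 B) ?kM ?orbT// !add0r.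
Qed.

Lemma block_join_lo N M L c d c' d' m x : block N M c d -> block M L c' d' ->
  (m <= 2 ^ M)%N -> wsum (fun k => d k + d' k) m x = wsum d m x.
Proof. by move=> B B' mM; rewrite wsum_add (block_sum0 _ B')// addr0. Qed.

Lemma block_join_hi N M L c d c' d' m x : block N M c d -> block M L c' d' ->
  (2 ^ M <= m)%N ->
  wsum (fun k => d k + d' k) m x = wsum d (2 ^ M) x + wsum d' m x.
Proof. by move=> B B' mM; rewrite wsum_add (block_sum _ B). Qed.

Lemma step_block_sum N M c d m : block N M c d -> step M (wsum d m).
Proof.
move=> B; have [mM|/ltnW mM] := leqP m (2 ^ M); first exact: step_wsum.
have [h hE] := @step_wsum R d (2 ^ M) M (leqnn _).
by exists h => x; rewrite (block_sum _ B).
Qed.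

(* [(1 + r + r' - r r') / 2] takes the values +-1 only, whereas changing one sign gives
   [(1 + r) (1 + r') / 2], of mean absolute value 1/2; products of such factors
   yield Walsh polynomials with coefficients equal in absolute value, one
   unimodular and the other of small L1 norm. *)
Lemma bet_iter N P : step N P -> exists A : R, forall i, exists c d (be : R -> R),
  let M := (N.+1 + i.*2)%N in
  [/\ block N M c d,
      mean (fun x => `|wsum c (2 ^ M) x|) = mean (fun x => `|P x|) / 2 ^+ i,
      [/\ step M be, forall x, be x * be x = 1 &
          forall F, step N F -> mean (fun x => F x * be x) = 0],
      forall x, wsum d (2 ^ M) x = P x * be x &
      forall m x, `|wsum d m x| <= 3 * `|P x| + A / 2 ^+ i].
Proof.
move=> sP.
have [p pE] := step_wsumP sP.
(* Multiplication of [P] by [rad N.+1] moves its frequencies above [2 ^ N]. The sum [A] of the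
   absolute values of the coefficients bounds all partial sums of this first polynomial. *)
pose c0 := dbl N (fun=> 0) p.
have B0 : block N N.+1 c0 c0.
  split=> // k /orP[kN|Nk]; first by rewrite /c0 /dbl kN.
  rewrite /c0 /dbl ltnNge (leq_trans _ Nk) ?leq_exp2l//=.
  by rewrite ltnNge Nk.
have c0E x : wsum c0 (2 ^ N.+1) x = P x * rad N.+1 x.
  by rewrite dbl_full wsum0// add0r -pE mulrC.
pose A := \sum_(0 <= k < 2 ^ N.+1) `|c0 k|.
exists A; elim=> [|i [c [d [be]]]] /=.
  rewrite addn0; exists c0, c0, (rad N.+1); split => //.
  - by rewrite expr0 divr1; apply: eq_mean => x; rewrite c0E normrM abs_rad mulr1.
  - split; [by apply: step_rad; rewrite leqnn|by move=> x; exact: rad_sq|].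
    exact: mean_rad.
  - move=> m x; rewrite expr0 divr1.
    have small m' : (m' <= 2 ^ N.+1)%N -> `|wsum c0 m' x| <= A.
      move=> m'N; rewrite /wsum /A (@big_cat_nat _ _ _ m' _ (2 ^ N.+1)%N)//=.
      apply: (le_trans (ler_norm_sum _ _ _)); rewrite ler_wpDr ?sumr_ge0//.
      by apply: ler_sum => k _; rewrite normrM abs_wal mulr1.
    have P0 : 0 <= 3 * `|P x| by rewrite mulr_ge0.
    have [mN|/ltnW mN] := leqP m (2 ^ N.+1); first by rewrite ler_wpDl// small.
    by rewrite (block_sum _ B0 mN) ler_wpDl// small.
set M := (N.+1 + i.*2)%N => -[B mc [sbe be2 mbe] dE dm].
have -> : (N.+1 + (i.+1).*2 = M.+2)%N by rewrite /M; lia.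
have NM : (N <= M)%N by case: B.
pose r (x : R) : R := rad M.+1 x; pose r' (x : R) : R := rad M.+2 x.
pose cc := dbl M c c.
(* Four copies in the patterns (c, c, c, c) and (d, d, d, -d), halved: the factors are
   [(1 + r) * (1 + r') / 2] and [(1 + r + r' - r * r') / 2]. *)
pose c' k := 2^-1 * dbl M.+1 cc cc k.
pose d' k := 2^-1 * dbl M.+1 (dbl M d d) (dbl M d (fun k => - d k)) k.
have wN v m x : wsum (fun k => - v k) m x = - wsum v m x.
  by rewrite -mulN1r -wsumZ; apply: eq_wsum => k _; rewrite mulN1r.
have c'E x : wsum c' (2 ^ M.+2) x = 2^-1 * (wsum c (2 ^ M) x * (1 + r x) * (1 + r' x)).
  by rewrite wsumZ !dbl_full -/(r x) -/(r' x); ring.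
have d'E x : wsum d' (2 ^ M.+2) x =
    wsum d (2 ^ M) x * (2^-1 * (1 + r x + r' x - r x * r' x)).
  by rewrite wsumZ !dbl_full wN -/(r x) -/(r' x); ring.
have sr : step M.+1 r by apply: step_rad; rewrite leqnn.
have sr' : step M.+2 r' by apply: step_rad; rewrite leqnn.
have sr2 : step M.+2 r := step_le (leqnSn _) sr.
exists c', d', (fun x => be x * (2^-1 * (1 + r x + r' x - r x * r' x))); split.
- case: B => _ cc0 dc; split; first by lia.
    move=> k /orP[kN|Mk].
      have kM : (k < 2 ^ M)%N by rewrite (leq_trans kN)// leq_exp2l.
      rewrite /c' /cc /dbl kM (leq_trans kM) ?leq_exp2l//.
      by rewrite cc0 ?kN// mulr0.
    rewrite /c' /dbl [in X in if X then _ else _]ltnNge (leq_trans _ Mk) ?leq_exp2l//=.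
    by rewrite ltnNge Mk /= mulr0.
  move=> k; rewrite /c' /d' !normrM; congr (_ * _).
  by apply: dbl_norm => {}k; apply: dbl_norm => {}k; rewrite ?normrN dc.
- pose C x := `|wsum c (2 ^ M) x|.
  have sC : step M C by apply: step_abs; exact: step_wsum.
  have sC1 : step M.+1 C := step_le (leqnSn _) sC.
  pose D x := C x + C x * r x.
  have sD : step M.+1 D by apply: stepD => //; apply: stepM.
  have sDr : step M.+2 (fun x => D x * r' x).
    by apply: stepM => //; exact: step_le sD.
  rewrite (@eq_mean _ _ (fun x => 2^-1 * (D x + D x * r' x))); last first.
    move=> x; rewrite c'E !normrM ger0_norm ?invr_ge0//.
    have r0 n : `|1 + rad n x| = 1 + rad n x :> R.
      by rewrite ger0_norm//; case: (rad_cases n x) => ->; rewrite ?subrr.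
    by rewrite !r0 /D /C -/(r x) -/(r' x); ring.
  have sD2 : step M.+2 D := step_le (leqnSn _) sD.
  have sCr : step M.+1 (fun x => C x * r x) by apply: stepM.
  rewrite (meanZ _ (stepD sD2 sDr)) (meanD sD2 sDr) (mean_rad sD) addr0.
  rewrite (meanD sC1 sCr) (mean_rad sC) addr0 mc exprS.
  by rewrite invfM; ring.
- split.
  + apply: stepM; first exact: (step_le (leq_trans (leqnSn _) (leqnSn _)) sbe).
    apply: stepZ; apply: stepB; last exact: stepM.
    by apply: stepD => //; apply: stepD => //; exact: step_cst.
  + move=> x; rewrite mulrACA be2 mul1r.
    by rewrite /r /r'; case: (rad_cases M.+1 x) => ->; case: (rad_cases M.+2 x) => ->; field.
  + move=> F sF; pose G x := F x * be x.
    have sG : step M G by apply: stepM => //; exact: step_le sF.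
    have sG1 : step M.+1 G := step_le (leqnSn _) sG.
    have sGr : step M.+1 (fun x => G x * r x) by apply: stepM.
    pose D1 x := G x + G x * r x; pose D2 x := G x - G x * r x.
    have sD1 : step M.+1 D1 by exact: stepD.
    have sD2 : step M.+1 D2 by exact: stepB.
    have sD1' : step M.+2 D1 := step_le (leqnSn _) sD1.
    have sD2' : step M.+2 (fun x => D2 x * r' x).
      by apply: stepM => //; exact: step_le sD2.
    rewrite (@eq_mean _ _ (fun x => 2^-1 * (D1 x + D2 x * r' x))); last first.
      by move=> x; rewrite /D1 /D2 /G; ring.
    rewrite (meanZ _ (stepD sD1' sD2')) (meanD sD1' sD2') (mean_rad sD2) addr0.
    by rewrite (meanD sG1 sGr) (mean_rad sG) addr0 mbe// mulr0.
- by move=> x; rewrite d'E dE mulrA.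
- move=> m x; rewrite wsumZ normrM ger0_norm ?invr_ge0//.
  have abe : `|be x| = 1.
    by apply/eqP; rewrite -sqr_norm_eq1 ?expr2 ?be2.
  have aD : `|wsum d (2 ^ M) x| = `|P x| by rewrite dE normrM abe mulr1.
  set B' := 3 * `|P x| + A / 2 ^+ i.
  have dm' m' : `|wsum d m' x| <= B' := dm m' x.
  (* Before halving, a partial sum contains at most three complete copies, each of absolute value
     [|P x|], and one incomplete copy. The constant 3 is the fixed point of [a -> (3 + a) / 2], so
     only the term in [A] changes, and it is halved. *)
  suff : `|wsum (dbl M.+1 (dbl M d d) (dbl M d (fun k => - d k))) m x| <= 3 * `|P x| + B'.
    move=> h; rewrite ler_pdivrMl// (le_trans h)// /B' exprS invfM; lra.
  have P0 : 0 <= `|P x| by [].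
  have [m' [->|->]] := dbl_partial M.+1 (dbl M d d) (dbl M d (fun k => - d k)) m x.
    have [m'' [->|->]] := dbl_partial M d d m' x.
      by rewrite (le_trans (dm' m''))// ler_wpDl// mulr_ge0.
    rewrite (le_trans (ler_normD _ _))// lerD// ?aD ?normrM ?abs_rad ?mul1r//.
    by lra.
  rewrite dbl_full -/(r x) -/(r' x).
  have ar : `|r x| = 1 by exact: abs_rad.
  have ar' : `|r' x| = 1 by exact: abs_rad.
  have [m'' [->|->]] := dbl_partial M d (fun k => - d k) m' x.
    rewrite (le_trans (ler_normD _ _))// lerD//.
      rewrite (le_trans (ler_normD _ _))// normrM ar mul1r aD; lra.
    by rewrite normrM ar' mul1r.
  rewrite wN -/(r x) mulrDr mulrN addrA.
  rewrite (le_trans (ler_normD _ _))// lerD//.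
    rewrite (le_trans (ler_normD _ _))// normrM ar' mul1r aD.
    have := ler_normD (wsum d (2 ^ M) x) (r x * wsum d (2 ^ M) x).
    by rewrite normrM ar mul1r aD; lra.
  by rewrite normrM ar' mul1r normrN normrM ar mul1r.
Qed.

End Blocks.

(** * Betting with Walsh polynomials *)

Section Stages.
Context {R : realType}.
Implicit Types (F G P : R -> R) (x y : R) (N M k j m : nat) (c d u v : nat -> R).

Lemma bet N P (eta : R) : step N P -> 0 < eta -> exists M c d (be : R -> R),
  [/\ block N M c d, mean (fun x => `|wsum c (2 ^ M) x|) <= eta,
      [/\ step M be, forall x, be x * be x = 1 &
          forall F, step N F -> mean (fun x => F x * be x) = 0],
      forall x, wsum d (2 ^ M) x = P x * be x &
      forall m x, `|wsum d m x| <= 3 * `|P x| + eta].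
Proof.
move=> sP eta0; have [A betA] := bet_iter sP.
have small (a : R) n : (Num.bound (a / eta) <= n)%N -> a / 2 ^+ n <= eta.
  move=> an; rewrite ler_pdivrMr ?exprn_gt0// -ler_pdivrMl// mulrC.
  exact: ltW (upper_nthrootP an).
set a := mean (fun x => `|P x|) in betA *.
have [c [d [be [B mc bebe dE dm]]]] := betA (maxn (Num.bound (a / eta)) (Num.bound (A / eta))).
exists (N.+1 + (maxn (Num.bound (a / eta)) (Num.bound (A / eta))).*2)%N, c, d, be.
split => //; first by rewrite mc small// leq_maxl.
by move=> m x; rewrite (le_trans (dm m x))// lerD2l small// leq_maxr.
Qed.

(* The stake is doubled after each loss, so that all the losses are recovered outside the
   set [b = 1] where every bet is lost. *)
Lemma doubling N P t (eta : R) : step N P -> 0 < eta -> exists M c d (b : R -> R),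
  [/\ block N M c d, mean (fun x => `|wsum c (2 ^ M) x|) <= eta,
      [/\ step M b, forall x, b x = 0 \/ b x = 1 &
          mean (fun x => `|P x| * b x) = mean (fun x => `|P x|) / 2 ^+ t],
      forall x, wsum d (2 ^ M) x = P x * (1 - 2 ^+ t * b x) &
      forall m, mean (fun x => `|wsum d m x|) <= 5 * mean (fun x => `|P x|) + eta].
Proof.
move=> sP; elim: t eta => [|t IH] eta eta0.
  have w0 m x : wsum (fun=> 0) m x = 0 :> R by apply: wsum0.
  have m0 m : mean (fun x : R => `|wsum (fun=> 0) m x|) = 0 :> R.
    by rewrite (@eq_mean _ _ (fun=> 0)) ?mean_cst// => x; rewrite w0 normr0.
  (* No bet has been placed yet: the block is empty and every point counts as losing, consistently
     with [P x * (1 - 2 ^+ 0) = 0]. *)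
  exists N, (fun=> 0), (fun=> 0), (fun=> 1); split.
  - by split.
  - by rewrite m0 ltW.
  - split; [exact: step_cst|by right|].
    by rewrite expr0 divr1; apply: eq_mean => x; rewrite mulr1.
  - by move=> x; rewrite w0 expr0 mulr1 subrr mulr0.
  - by move=> m; rewrite m0; apply: addr_ge0; [apply: mulr_ge0 => //; exact: mean_ge0|exact: ltW].
have e2 : 0 < eta / 2 by rewrite divr_gt0.
have [M [c [d [b [B mc [sb b01 mb] dE dm]]]]] := IH _ e2.
have NM : (N <= M)%N by case: B.
have sPM := step_le NM sP.
(* The next stake is placed on the losing set only. Where [be = 1] the balance [P * (1 - 2 ^+ t)]
   returns to [P]; where [be = -1] it becomes [P * (1 - 2 ^+ t.+1)]. As the bet is fair, the mean of
   [|P|] over the losing set is halved. *)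
have sP' : step M (fun x => 2 ^+ t * P x * b x) by apply: stepM => //; exact: stepZ.
have [M' [c' [d' [be [B' mc' [sbe be2 mbe] dE' dm']]]]] := bet sP' e2.
have MM' : (M <= M')%N by case: B'.
have beV x : be x = 1 \/ be x = -1.
  have : (be x - 1) * (be x + 1) = 0 by rewrite -subr_sqr expr1n expr2 be2 subrr.
  by move=> /eqP; rewrite mulf_eq0 subr_eq0 addr_eq0 => /orP[]/eqP; [left|right].
have b0 x : 0 <= b x by case: (b01 x) => ->.
have bb x : `|b x| = b x by rewrite ger0_norm.
have sPb : step M (fun x => `|P x| * b x) by apply: stepM => //; exact: step_abs.
have sPb' : step M' (fun x => `|P x| * b x) := step_le MM' sPb.
exists M', (fun k => c k + c' k), (fun k => d k + d' k), (fun x => b x * (1 - be x) / 2).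
split.
- exact: block_join B B'.
- apply: (@le_trans _ _ (mean (fun x => `|wsum c (2 ^ M) x| + `|wsum c' (2 ^ M') x|))).
    apply: (@le_mean _ M').
    + by apply: step_abs; exact: step_wsum.
    + apply: stepD; apply: step_abs; last exact: step_wsum.
      by apply: (step_le MM'); exact: step_wsum.
    + move=> x; rewrite (block_join_hi _ (block_c B) (block_c B')) ?ler_normD//.
      by rewrite leq_exp2l.
  rewrite (@meanD _ M').
  + by rewrite (le_trans (lerD mc mc'))// -splitr.
  + by apply: (step_le MM'); apply: step_abs; exact: step_wsum.
  + by apply: step_abs; exact: step_wsum.
- split.
  + have s1 : step M' (fun x => b x * (1 - be x)).
      apply: stepM; first exact: step_le sb.
      by apply: stepB => //; exact: step_cst.
    by have [h hE] := stepZ (2^-1) s1; exists h => x; rewrite -hE mulrC.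
  + move=> x; case: (b01 x) => ->; first by left; rewrite !mul0r.
    by case: (beV x) => ->; [left|right]; field.
  + have sPbe : step M' (fun x => `|P x| * b x * be x) by exact: stepM.
    rewrite (@eq_mean _ _ (fun x => 2^-1 * (`|P x| * b x - `|P x| * b x * be x))).
      by rewrite (meanZ _ (stepB sPb' sPbe)) (meanB sPb' sPbe) mbe// subr0 mb exprS; field; rewrite expf_neq0.
    by move=> x; field.
- by move=> x; rewrite (block_join_hi _ B B') ?leq_exp2l// dE dE' exprS; field.
- move=> m; have P0 : 0 <= mean (fun x => `|P x|) by exact: mean_ge0.
  have [mM|/ltnW Mm] := leqP m (2 ^ M).
    rewrite (@eq_mean _ _ (fun x => `|wsum d m x|)); last first.
      by move=> x; rewrite (block_join_lo _ B B').
    by rewrite (le_trans (dm m))// lerD2l ler_pdivrMr// ler_pMr// ler1n.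
  have sPa : step M' (fun x => `|P x|) by apply: step_abs; exact: step_le sPM.
  (* The balance so far is at most [|P| * (1 + 2 ^+ t * b)] and the running bet at most three times
     the stake, up to [eta / 2]. Since [|P| * b] has mean [2 ^- t] times that of [|P|], the total is
     1 + 4 = 5 times the mean of [|P|], whatever [t]. *)
  pose Q x := `|P x| + 4 * (2 ^+ t * (`|P x| * b x)).
  have sQ : step M' Q by apply: stepD => //; do 2 apply: stepZ.
  apply: (@le_trans _ _ (mean (fun x => Q x + eta / 2))).
    apply: (@le_mean _ M').
    + apply: step_abs; have [h hE] := stepD (step_le MM' (step_block_sum (2 ^ M) B)) (step_block_sum m B').
      by exists h => x; rewrite (block_join_hi _ B B').
    + by apply: stepD => //; exact: step_cst.
    + move=> x; rewrite (block_join_hi _ B B')// (le_trans (ler_normD _ _))//.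
      rewrite dE /Q; have := dm' m x; rewrite !normrM bb ger0_norm ?exprn_ge0//.
      have : `|1 - 2 ^+ t * b x| <= 1 + 2 ^+ t * b x.
        rewrite (le_trans (ler_normB _ _))// normr1 normrM bb ger0_norm ?exprn_ge0//.
      move=> h1 h2.
      have : `|P x| * `|1 - 2 ^+ t * b x| <= `|P x| * (1 + 2 ^+ t * b x) by rewrite ler_wpM2l.
      by lra.
  rewrite (meanD sQ (step_cst _ _)) mean_cst (meanD sPa) ?(@meanZ _ M') ?mb//.
  - set a := mean _; rewrite (_ : 2 ^+ t * (a / 2 ^+ t) = a); first by lra.
    by rewrite mulrCA divff ?mulr1// expf_neq0.
  - exact: stepZ.
  - by do 2 apply: stepZ.
Qed.

Definition among n (ws : seq (seq bool)) x : R := (bits n x \in ws)%:R.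

Lemma step_among n ws : step n (among n ws).
Proof. by exists (fun w => (w \in ws)%:R). Qed.

Lemma mean_among_le1 n ws : mean (among n ws) <= 1.
Proof.
rewrite -[leRHS](@mean_cst R) (le_mean (step_among n ws) (step_cst _ _))// => x.
by rewrite /among lern1 leq_b1.
Qed.

(* Distinct dyadic intervals of rank [n] are served by disjoint blocks of frequencies, so
   that the sign [h] may be chosen on each of them after the coefficients [c]. *)
Lemma stage_words n (g : R) t (eta : R) (ws : seq (seq bool)) :
  uniq ws -> 0 < g -> 0 < eta -> exists M c (b : R -> R),
  [/\ step M b, forall x, b x = 0 \/ b x = 1,
      mean (fun x => `|wsum c (2 ^ M) x|) <= eta,
      mean (fun x => among n ws x * b x) = mean (among n ws) / 2 ^+ t &
      forall h : seq bool -> R, (forall w, h w * h w = 1) -> exists d,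
      [/\ block n M c d,
          forall x, wsum d (2 ^ M) x =
            h (bits n x) * g * among n ws x * (1 - 2 ^+ t * b x) &
          forall m, mean (fun x => `|wsum d m x|) <= 7 * g + eta]].
Proof.
move=> + g0; elim: ws eta => [|w ws IH] eta /=.
  move=> _ eta0; have w0 m x : wsum (fun=> 0) m x = 0 :> R by apply: wsum0.
  have m0 m : mean (fun x : R => `|wsum (fun=> 0) m x|) = 0 :> R.
    by rewrite (@eq_mean _ _ (fun=> 0)) ?mean_cst// => x; rewrite w0 normr0.
  have am0 x : among n [::] x = 0 by [].
  exists n, (fun=> 0), (fun=> 0); split.
  - exact: step_cst.
  - by left.
  - by rewrite m0 ltW.
  - rewrite [LHS](@eq_mean _ _ (fun=> 0)); last by move=> x; rewrite mulr0.
    by rewrite [in RHS](eq_mean am0) !mean_cst mul0r.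
  - move=> h _; exists (fun=> 0); split; first by split.
      by move=> x; rewrite w0 am0 mulr0 mul0r.
    by move=> m; rewrite m0 addr_ge0// ?mulr_ge0// ltW.
move=> /andP[wws uws] eta0; have e2 : 0 < eta / 2 by rewrite divr_gt0.
have [M [c [b [sb b01 mc mb Hd]]]] := IH _ uws e2.
(* The constant sign gives access to the frequency range of [c], which does not depend on [h]. *)
have [d1 [B1 _ _]] := Hd (fun=> 1) (fun=> mulr1 1).
have nM : (n <= M)%N by case: B1.
pose P x := g * among n [:: w] x.
have sw := step_among n [:: w]; have sws := step_among n ws.
have sP : step M P by apply: stepZ; exact: step_le sw.
have am0 ws' x : 0 <= among n ws' x by rewrite /among ler0n.
have aP x : `|P x| = P x by rewrite ger0_norm// mulr_ge0// ltW.
have [M' [c' [d' [b' [B' mc' [sb' b01' mb'] dE' dm']]]]] := doubling t sP e2.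
have MM' : (M <= M')%N by case: B'.
pose bb x := if bits n x == w then b' x else b x.
have amE x : among n (w :: ws) x = among n [:: w] x + among n ws x.
  rewrite /among !inE; case: eqP => [->|_]; last by rewrite add0r.
  by rewrite (negPf wws) addr0.
have bbE x : bb x = among n [:: w] x * b' x + (1 - among n [:: w] x) * b x.
  by rewrite /bb /among inE; case: eqP => _; rewrite ?subrr ?subr0 ?mul0r ?mul1r ?addr0 ?add0r.
have ambb x : among n (w :: ws) x * bb x = among n [:: w] x * b' x + among n ws x * b x.
  rewrite amE /bb /among inE; case: eqP => [->|_]; last by rewrite !mul0r !add0r.
  by rewrite (negPf wws) !mul0r !addr0.
have nM' := leq_trans nM MM'.
have swM' := step_le nM' sw; have sbM' := step_le MM' sb.
have abs_le v m L : step L (wsum v m) -> step L (fun x => `|wsum v m x|) by exact: step_abs.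
exists M', (fun k => c k + c' k), bb; split.
- have [f fE] : step M' (fun x => among n [:: w] x * b' x + (1 - among n [:: w] x) * b x).
    by apply: stepD; apply: stepM => //; apply: stepB => //; exact: step_cst.
  by exists f => x; rewrite bbE.
- by move=> x; rewrite /bb; case: eqP.
- apply: (@le_trans _ _ (mean (fun x => `|wsum c (2 ^ M) x| + `|wsum c' (2 ^ M') x|))).
    apply: (@le_mean _ M').
    + by apply: step_abs; exact: step_wsum.
    + apply: stepD; apply: step_abs; last exact: step_wsum.
      by apply: (step_le MM'); exact: step_wsum.
    + move=> x; rewrite (block_join_hi _ (block_c B1) (block_c B')) ?ler_normD//.
      by rewrite leq_exp2l.
  rewrite (@meanD _ M').
  + by rewrite (le_trans (lerD mc mc'))// -splitr.
  + by apply: (step_le MM'); apply: step_abs; exact: step_wsum.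
  + by apply: step_abs; exact: step_wsum.
- rewrite (eq_mean ambb) (eq_mean amE) (meanD sw sws) (@meanD _ M'); first last.
  + by apply: stepM => //; exact: (step_le nM').
  + by apply: stepM.
  rewrite mb mulrDl; congr (_ + _); apply: (mulfI (lt0r_neq0 g0)).
  rewrite mulrA -(meanZ _ sw) -(@meanZ _ M'); last exact: stepM.
  rewrite -(eq_mean aP) -mb'; apply: eq_mean => x.
  by rewrite aP mulrA.
- move=> h h2; have [d [B dE dm]] := Hd h h2.
  have hw : `|h w| = 1 by apply/eqP; rewrite -sqr_norm_eq1 ?expr2 ?h2.
  have B'' : block M M' c' (fun k => h w * d' k).
    by case: B' => ? ? dc'; split => // k; rewrite normrM hw mul1r.
  exists (fun k => d k + h w * d' k); split.
  + exact: block_join B B''.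
  + move=> x; rewrite (block_join_hi _ B B'') ?leq_exp2l// wsumZ dE dE' amE /bb /P /among inE.
    case: eqP => [->|_]; last by rewrite mulr0 mul0r mulr0 addr0 add0r.
    by rewrite (negPf wws) mulr0 mul0r add0r addr0; ring.
  + move=> m; have [mM|/ltnW Mm] := leqP m (2 ^ M).
      rewrite (@eq_mean _ _ (fun x => `|wsum d m x|)); last first.
        by move=> x; rewrite (block_join_lo _ B B'').
      by rewrite (le_trans (dm m))// lerD2l ler_pdivrMr// ler_pMr// ler1n.
    (* With [a1] and [a2] the measures of the current interval and of those in [ws], the finished
       words cost at most [2 * g * a2] in mean and the current one [5 * g * a1 + eta / 2]. As
       [a1 + a2 <= 1], the bound [7 * g + eta] does not grow with the number of words. *)
    pose Q x := g * among n ws x + g * (2 ^+ t * (among n ws x * b x)).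
    have sab : step M (fun x => among n ws x * b x) by apply: stepM => //; exact: step_le sws.
    have sQ : step M Q.
      by apply: stepD; [apply: stepZ; exact: step_le sws|do 2 apply: stepZ].
    have sd' : step M' (fun x => `|wsum d' m x|).
      by apply: step_abs; exact: (step_block_sum m B').
    apply: (@le_trans _ _ (mean (fun x => Q x + `|wsum d' m x|))).
      apply: (@le_mean _ M').
      * apply: step_abs; have [f fE] := stepD (step_le MM' (step_block_sum (2 ^ M) B)) (step_block_sum m B'').
        by exists f => x; rewrite (block_join_hi _ B B'').
      * by apply: stepD => //; exact: step_le sQ.
      * move=> x; rewrite (block_join_hi _ B B'')// (le_trans (ler_normD _ _))//.
        rewrite wsumZ normrM hw mul1r lerD2r dE !normrM.
        have -> : `|h (bits n x)| = 1 by apply/eqP; rewrite -sqr_norm_eq1 ?expr2 ?h2.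
        rewrite mul1r (gtr0_norm g0) (ger0_norm (am0 _ _)).
        have : `|1 - 2 ^+ t * b x| <= 1 + 2 ^+ t * b x.
          rewrite (le_trans (ler_normB _ _))// normr1 normrM ger0_norm ?exprn_ge0//.
          by case: (b01 x) => ->; rewrite ?normr0 ?normr1.
        move=> hb; rewrite /Q.
        have : g * among n ws x * `|1 - 2 ^+ t * b x| <= g * among n ws x * (1 + 2 ^+ t * b x).
          by rewrite ler_wpM2l// mulr_ge0// ltW.
        by move=> /le_trans; apply; rewrite le_eqVlt; apply/orP; left; apply/eqP; ring.
    rewrite (meanD (step_le MM' sQ) sd').
    have -> : mean Q = g * mean (among n ws) +
        g * (2 ^+ t * mean (fun x => among n ws x * b x)).
      have sA := step_le nM sws.
      rewrite (meanD (stepZ g sA) (stepZ g (stepZ _ sab))) (meanZ _ sws).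
      by rewrite (meanZ _ (stepZ _ sab)) (meanZ _ sab).
    rewrite mb; have := dm' m; rewrite (eq_mean aP) (meanZ _ sw).
    have := mean_among_le1 n (w :: ws); rewrite (eq_mean amE) (meanD sw sws).
    have mw0 : 0 <= mean (among n [:: w]) by exact: mean_ge0.
    have ms0 : 0 <= mean (among n ws) by exact: mean_ge0.
    set a1 := mean (among n [:: w]) in mw0 *; set a2 := mean (among n ws) in ms0 *.
    rewrite (_ : 2 ^+ t * (a2 / 2 ^+ t) = a2); last first.
      by rewrite mulrCA divff ?mulr1// expf_neq0.
    move=> a12 dm1.
    have h1 : g * a1 + g * a2 <= g by rewrite -mulrDr ger_pMr.
    have h2' : 0 <= g * a1 by rewrite mulr_ge0// ltW.
    have h3' : 0 <= g * a2 by rewrite mulr_ge0// ltW.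
    lra.
Qed.

Lemma stage n (g : R) t (eta : R) : 0 < g -> 0 < eta -> exists M c (b : R -> R),
  [/\ step M b, forall x, b x = 0 \/ b x = 1,
      mean (fun x => `|wsum c (2 ^ M) x|) <= eta,
      mean b = 2 ^- t &
      forall s : R -> R, step n s -> (forall x, s x * s x = 1) -> exists d,
      [/\ block n M c d,
          forall x, wsum d (2 ^ M) x = s x * g * (1 - 2 ^+ t * b x) &
          forall m, mean (fun x => `|wsum d m x|) <= 7 * g + eta]].
Proof.
move=> g0 eta0.
pose ws := [seq val w | w <- enum {: n.-tuple bool}].
have uws : uniq ws by rewrite map_inj_uniq ?enum_uniq//; exact: val_inj.
have am1 x : among n ws x = 1.
  rewrite /among; have szn : size (bits n x) == n by rewrite size_bits.
  by have -> : bits n x \in ws by apply/mapP; exists (Tuple szn); rewrite ?mem_enum.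
have [M [c [b [sb b01 mc mb Hd]]]] := stage_words n t uws g0 eta0.
exists M, c, b; split => //.
  rewrite (eq_mean am1) mean_cst mul1r in mb; rewrite -mb.
  by apply: eq_mean => x; rewrite am1 mul1r.
(* The hypothesis on [s] constrains [h0] only at the words [bits n x]; all other words where it is
   not a sign are given the sign 1. *)
move=> s [h0 hE] s2; pose h w := if h0 w * h0 w == 1 then h0 w else 1.
have hs x : h (bits n x) = s x by rewrite /h hE -hE s2 eqxx.
have [|d [B dE dm]] := Hd h.
  by move=> w; rewrite /h; case: eqP => // _; rewrite mulr1.
by exists d; split => // x; rewrite dE hs am1 mulr1.
Qed.

End Stages.

(** * Reaching a moving target by steps of divergent sum *)

Section Steering.
Context {R : realType}.

Lemma harmonic_tail (s0 : nat) (A : R) :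
  exists2 s, (s0 <= s)%N & A <= \sum_(s0 <= j < s) @harmonic R j.
Proof.
apply: contrapT => /forall2NP h; apply: (@dvg_harmonic R).
apply: nondecreasing_is_cvgn.
  by apply: nondecreasing_series => n _ _; exact: harmonic_ge0.
exists (\sum_(0 <= j < s0) @harmonic R j + `|A|) => _ [s _ <-].
rewrite seriesEnat /=; have [ss|ss] := leqP s0 s.
  have [/(_ ss)//|/negP] := h s; rewrite -ltNge => sA.
  rewrite (@big_cat_nat _ _ _ s0)//= lerD2l.
  by rewrite (le_trans (ltW sA))// ler_norm.
rewrite [X in _ <= X + _](@big_cat_nat _ _ _ s)//=; last exact: ltnW.
rewrite -addrA lerDl addr_ge0// sumr_ge0// => i _; exact: harmonic_ge0.
Qed.

(** A step of size [harmonic s] towards the target either shortens the error by that amount or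
    overshoots by no more than that; [d s] is the motion of the target. Divergence of the harmonic
    series exhausts any error, and the small tails of [d] cannot restore it. *)
Lemma steering (u d : nat -> R) (s0 : nat) :
  (forall s, 0 <= d s) ->
  (forall e, 0 < e -> exists s1, forall s, \sum_(s1 <= j < s) d j <= e) ->
  (forall s, (s0 <= s)%N -> `|u s.+1| <=
    Num.max (`|u s| - @harmonic R s) (@harmonic R s) + d s) ->
  u @ \oo --> 0.
Proof.
move=> d0 dsum ustep; apply/cvgrPdist_le => e e0.
have e2 : 0 < e / 2 by rewrite divr_gt0.
have [s1 hs1] := dsum _ e2.
have [s2 hs2] : exists s2, forall s, (s2 <= s)%N -> @harmonic R s <= e / 2.
  have [s2 _ h] : \forall s \near \oo, `|0 - @harmonic R s| <= e / 2.
    by have /cvgrPdist_le := @cvg_harmonic R; exact.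
  exists s2 => s /h /=; by rewrite sub0r normrN ger0_norm// harmonic_ge0.
pose s3 := maxn s0 (maxn s1 s2).
have [l03 [l13 l23]] : (s0 <= s3 /\ s1 <= s3 /\ s2 <= s3)%N by rewrite /s3; lia.
have dtail s : \sum_(s3 <= j < s) d j <= e / 2.
  have [ss|ss] := leqP s3 s; last by rewrite (big_geq (ltnW ss)) ltW.
  by apply: le_trans (hs1 s); rewrite [leRHS](@big_cat_nat _ _ _ s3)//= lerDr sumr_ge0.
(* Up to the drift, either all the steps since [s3] have shortened the error, or it has been trapped
   below [e / 2]. The first alternative ends once the steps add up to the error at [s3]. *)
have main s : (s3 <= s)%N -> `|u s| <=
    Num.max (`|u s3| - \sum_(s3 <= j < s) @harmonic R j) (e / 2) + \sum_(s3 <= j < s) d j.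
  elim: s => [|s IH]; first by rewrite leqn0 => /eqP ->; rewrite !big_geq// subr0 addr0 le_max lexx.
  rewrite leq_eqVlt => /predU1P[<-|]; first by rewrite !big_geq// subr0 addr0 le_max lexx.
  rewrite ltnS => ss; have {IH} := IH ss; have := ustep s (leq_trans l03 ss).
  rewrite !big_nat_recr//=; have := hs2 s (leq_trans l23 ss).
  have := @harmonic_ge0 R s.
  set g := harmonic s; set X := \sum_(_ <= _ < _) _; set Y := \sum_(_ <= _ < _) _.
  move=> g0 g2 h1 h2; apply: (le_trans h1); rewrite addrA lerD2r.
  have Y0 : 0 <= Y by apply: sumr_ge0.
  rewrite ge_max; apply/andP; split.
    rewrite -(lerD2r g) subrK (le_trans h2)// addrAC lerD2r.
    rewrite ge_max; apply/andP; split.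
      by rewrite -lerBlDr le_max; apply/orP; left; rewrite opprD addrA.
    by rewrite -[leLHS]addr0 lerD// le_max lexx orbT.
  by rewrite -[leLHS]addr0 lerD// le_max g2 orbT.
have [s4 s34 hs4] := harmonic_tail s3 `|u s3|.
exists s4 => // s /= s4s; rewrite sub0r normrN.
have s3s := leq_trans s34 s4s.
apply: (le_trans (main s s3s)); rewrite [leRHS]splitr lerD//.
rewrite ge_max lexx andbT (le_trans _ (ltW e2))// subr_le0 (le_trans hs4)//.
by rewrite [leRHS](@big_cat_nat _ _ _ s4)//= lerDl sumr_ge0.
Qed.

End Steering.

(** * Density of step functions *)

Import HBSimple.

Section Density.
Context {R : realType}.
Implicit Types (F G h : R -> R) (x y : R) (N M k : nat).

Notation lambda := (leb R).
Notation U := (unit_itv R).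
Local Notation mU := (@measurable_unit_itv R).

Lemma aeS (P Q : leb_line R -> Prop) : (forall x, P x -> Q x) ->
  {ae lambda, forall x, P x} -> {ae lambda, forall x, Q x}.
Proof.
by move=> PQ; apply: (@filterS _ _ (ae_filter_ringOfSetsType lambda)) => x; exact: PQ.
Qed.

Lemma aeI (P Q : leb_line R -> Prop) : {ae lambda, forall x, P x} ->
  {ae lambda, forall x, Q x} -> {ae lambda, forall x, P x /\ Q x}.
Proof. exact: (@filterI _ _ (ae_filter_ringOfSetsType lambda)). Qed.

Lemma ae_neq (c : R) : {ae lambda, forall x : leb_line R, x <> c}.
Proof.
exists [set` `[c, c]]; split.
- by apply: measurable_leb_line; exact: measurable_itv.
- by apply: etrans (leb_itv _) _; rewrite /= ltxx.
- by move=> x /= /contrapT ->; rewrite in_itv/= lexx.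
Qed.

Lemma cvge0_near (u : nat -> \bar R) (e : R) : u @ \oo --> 0%E -> 0 < e ->
  \forall m \near \oo, (u m < e%:E)%E.
Proof.
move=> u0 e0; have n0 : nbhs (0%E : \bar R) [set y | (y < e%:E)%E].
  by apply: open_nbhs_nbhs; split; [exact: open_ereal_lt_ereal|rewrite /= lte_fin].
exact: u0 n0.
Qed.

Lemma cvge0_lt (u : nat -> \bar R) (e : R) : u @ \oo --> 0%E -> 0 < e ->
  exists n, (u n < e%:E)%E.
Proof. by move=> u0 /(cvge0_near u0)[n _ h]; exists n; exact: (h n (leqnn n)). Qed.

Definition L1 F : \bar R := (\int[lambda]_(x in U) (`|F x|)%:E)%E.

Lemma measurable_step N F : step N F -> leb_measurable_fun F.
Proof.
by move=> sF; apply/measurable_EFinP; exact: measurable_int (integrable_step sF).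
Qed.

Lemma measurable_normE F : leb_measurable_fun F ->
  measurable_fun U (fun x : leb_line R => (`|F x|)%:E).
Proof. by move=> mF; apply/measurable_EFinP; exact: measurableT_comp. Qed.

Lemma L1_leD F G h : leb_measurable_fun F -> leb_measurable_fun G ->
  leb_measurable_fun h ->
  (forall x, U x -> `|F x| <= `|G x| + `|h x|) -> (L1 F <= L1 G + L1 h)%E.
Proof.
move=> mF mG mh FG.
have n0 (k : R -> R) (x : leb_line R) : U x -> (0 <= (`|k x|)%:E)%E by rewrite lee_fin.
rewrite /L1 -(ge0_integralD _ mU (n0 G) (measurable_normE mG) (n0 h) (measurable_normE mh)).
apply: ge0_le_integral; first exact: mU.
- exact: n0.
- exact: (measurable_normE mF).
- by apply: emeasurable_funD; [exact: (measurable_normE mG)|exact: (measurable_normE mh)].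
- by move=> x Ux; rewrite -EFinD lee_fin FG.
Qed.

Lemma L1Z (a : R) F : leb_measurable_fun F -> L1 (fun x => a * F x) = (`|a|%:E * L1 F)%E.
Proof.
move=> mF; rewrite /L1 -(ge0_integralZl _ mU (measurable_normE mF)); first last.
- by rewrite lee_fin.
- by move=> x _; rewrite lee_fin.
by apply: eq_integral => x _; rewrite normrM EFinM.
Qed.

Definition step_approx h := leb_measurable_fun h /\
  forall e : R, 0 < e -> exists N F, step N F /\ (L1 (fun x => h x - F x)%R < e%:E)%E.

Lemma measurable_fun_sub F G : leb_measurable_fun F -> leb_measurable_fun G ->
  leb_measurable_fun (fun x => F x - G x).
Proof. exact: measurable_funB. Qed.

(** A common source for the closure under sums, multiples and maxima. *)
Lemma step_approx_lip (K : R) (f : R -> R -> R) h1 h2 : 0 < K ->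
  (forall a b c d, `|f a b - f c d| <= K * (`|a - c| + `|b - d|)) ->
  leb_measurable_fun (fun x => f (h1 x) (h2 x)) ->
  step_approx h1 -> step_approx h2 -> step_approx (fun x => f (h1 x) (h2 x)).
Proof.
move=> K0 fK mf [mh1 H1] [mh2 H2]; split=> // e e0.
have e2 : 0 < e / K / 2 by rewrite !divr_gt0.
have [N1 [F1 [s1 l1]]] := H1 _ e2; have [N2 [F2 [s2 l2]]] := H2 _ e2.
have s1' := step_le (leq_maxl N1 N2) s1; have s2' := step_le (leq_maxr N1 N2) s2.
exists (maxn N1 N2), (fun x => f (F1 x) (F2 x)); split; first exact: step_comp2.
have m1 := measurable_fun_sub mh1 (measurable_step s1).
have m2 := measurable_fun_sub mh2 (measurable_step s2).
apply: (@le_lt_trans _ _ (L1 (fun x => K * (h1 x - F1 x)%R)%R + L1 (fun x => K * (h2 x - F2 x))%R)%E).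
  apply: L1_leD.
  - by apply: measurable_fun_sub => //; exact: measurable_step (step_comp2 f s1' s2').
  - exact: measurable_funM.
  - exact: measurable_funM.
  - by move=> x _; rewrite (le_trans (fK _ _ _ _))// !normrM (gtr0_norm K0) -mulrDr.
rewrite !L1Z// (gtr0_norm K0) -muleDr//; last first.
  by rewrite ge0_adde_def// inE; apply: integral_ge0 => x _; rewrite lee_fin.
rewrite -lte_pdivlMl// -EFinM mulrC.
by rewrite [X in (_ < X%:E)%E]splitr EFinD lteD.
Qed.

Lemma step_approx_lim h : leb_measurable_fun h ->
  (forall e : R, 0 < e -> exists h', step_approx h' /\ (L1 (fun x => h x - h' x)%R < e%:E)%E) ->
  step_approx h.
Proof.
move=> mh H; split=> // e e0; have e2 : 0 < e / 2 by rewrite divr_gt0.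
have [h' [[mh' ah'] l1]] := H _ e2; have [N [F [sF l2]]] := ah' _ e2.
exists N, F; split=> //.
apply: (@le_lt_trans _ _ (L1 (fun x => h x - h' x)%R + L1 (fun x => h' x - F x)%R)%E).
  apply: L1_leD; try by apply: measurable_fun_sub => //; exact: measurable_step sF.
  by move=> x _; rewrite -[X in `|X|](subrKA (h' x)) ler_normD.
by rewrite [X in (_ < X%:E)%E]splitr EFinD lteD.
Qed.

Lemma step_approx_step N F : step N F -> step_approx F.
Proof.
move=> sF; split; first exact: measurable_step sF.
move=> e e0; exists N, F; split=> //.
by rewrite /L1 integral0_eq// => x _; rewrite subrr normr0.
Qed.

Lemma step_approxD h1 h2 : step_approx h1 -> step_approx h2 ->
  step_approx (fun x => h1 x + h2 x).
Proof.
move=> a1 a2; apply: (step_approx_lip ltr01 _ _ a1 a2).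
- by move=> a b c d; rewrite mul1r opprD addrACA ler_normD.
- by apply: measurable_funD; [case: a1|case: a2].
Qed.

Lemma step_approxZ (a : R) h : step_approx h -> step_approx (fun x => a * h x).
Proof.
move=> ah; have K0 : 0 < `|a| + 1 by rewrite ltr_wpDl.
apply: (@step_approx_lip _ (fun u _ => a * u) h h K0 _ _ ah ah).
- move=> u v w z; rewrite -mulrBr normrM ler_pM// ?lerDl//.
- by apply: measurable_funM => //; case: ah.
Qed.

Lemma step_approx_max h1 h2 : step_approx h1 -> step_approx h2 ->
  step_approx (fun x => Num.max (h1 x) (h2 x)).
Proof.
move=> a1 a2; apply: (step_approx_lip ltr01 _ _ a1 a2).
- move=> a b c d; rewrite mul1r.
  have h u v w z : Num.max u v <= Num.max w z + (`|u - w| + `|v - z|) :> R.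
    have [n1 n2] : 0 <= `|u - w| /\ 0 <= `|v - z| by [].
    have l1 : u - w <= `|u - w| by exact: ler_norm.
    have l2 : v - z <= `|v - z| by exact: ler_norm.
    have l3 : w <= Num.max w z by rewrite le_max lexx.
    have l4 : z <= Num.max w z by rewrite le_max lexx orbT.
    by rewrite ge_max; apply/andP; split; lra.
  rewrite ler_norml; apply/andP; split; last by have := h a b c d; lra.
  by have := h c d a b; rewrite [`|c - a|]distrC [`|d - b|]distrC; lra.
- by apply: measurable_maxr; [case: a1|case: a2].
Qed.

(* A point of the dyadic interval of [0, 1) coded by [w] (0 if there is none). *)
Definition unit_rep N (w : seq bool) : R := xget 0 [set y | 0 <= y < 1 /\ bits N y = w].

Lemma bits_truncn N x y : 0 <= x < 1 -> 0 <= y < 1 -> bits N x = bits N y ->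
  Num.truncn (2 ^+ N * x) = Num.truncn (2 ^+ N * y).
Proof.
move=> /andP[x0 x1] /andP[y0 y1]; elim: N => [_|N IH e].
  have t0 (z : R) : 0 <= z -> z < 1 -> Num.truncn (2 ^+ 0 * z) = 0%N.
    by move=> z0 z1; apply: truncn_def; rewrite expr0 mul1r z0.
  by rewrite !t0.
have [eN eb] : bits N x = bits N y /\ bit N.+1 x = bit N.+1 y.
  by have /= := rcons_inj e => -[].
rewrite -[LHS]odd_double_half -[RHS]odd_double_half -!truncn_half (IH eN).
by rewrite [odd _]eb.
Qed.

Lemma unit_rep_dist N x : 0 <= x < 1 -> `|x - unit_rep N (bits N x)| < 2 ^- N.
Proof.
move=> x01; rewrite /unit_rep; case: xgetP => [y _ [y01 yx]|/(_ x)]; last by case.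
have p0 : 0 < (2 ^+ N : R) by rewrite exprn_gt0.
have tE := bits_truncn y01 x01 yx.
have y0 : 0 <= 2 ^+ N * y by case/andP: y01 => ? _; rewrite mulr_ge0.
have x0 : 0 <= 2 ^+ N * x by case/andP: x01 => ? _; rewrite mulr_ge0.
have := truncn_itv y0; have := truncn_itv x0; rewrite tE.
set t := Num.truncn _; have -> : t.+1%:R = t%:R + 1 :> R by rewrite natr1.
move=> /andP[a1 a2] /andP[b1 b2].
have pv : 2 ^+ N * 2 ^- N = 1 :> R by rewrite divff ?gt_eqF.
rewrite -(ltr_pM2l p0) pv -(gtr0_norm p0) -normrM mulrBr.
by rewrite ltr_norml; apply/andP; split; lra.
Qed.

(** The indicator is sampled at one point of each dyadic cell; at a fixed point away from the ends
    of the interval, fine enough samples are exact. *)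
Lemma step_approx_ocitv (a b : R) : step_approx (\1_[set` `]a, b]]).
Proof.
pose F : R -> R := \1_[set` `]a, b]].
have mF : leb_measurable_fun F.
  apply: measurable_funTS; apply: measurable_indic.
  by apply: measurable_leb_line; exact: measurable_itv.
pose FN N x := F (unit_rep N (bits N x)).
have sFN N : step N (FN N) by exists (F \o unit_rep N).
split=> // e e0.
have [|||||_ + _] := @dominated_convergence _ _ _ lambda U mU
    (fun N x => (FN N x)%:E) (fun x => (F x)%:E) (cst 1%E).
- by move=> N; apply/measurable_EFinP; exact: measurable_step (sFN N).
- exact/measurable_EFinP.
(* The point 1 is discarded too: its digits are those of 0, so the sample for its cell is not close
   to it. *)
- apply: aeS (aeI (aeI (ae_neq a) (ae_neq b)) (ae_neq 1)) => x [[xa xb] x1] /andP[Ux0 Ux1].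
  have x01 : 0 <= x < 1 by rewrite Ux0 lt_neqAle Ux1 andbT; apply/eqP.
  have [D D0 Dab] : exists2 D : R, 0 < D & D <= `|x - a| /\ D <= `|x - b|.
    exists (Num.min `|x - a| `|x - b|).
      by rewrite lt_min !normr_gt0 !subr_eq0; apply/andP; split; apply/eqP.
    by rewrite !ge_min !lexx orbT.
  suff H : \forall N \near \oo, (FN N x)%:E = (F x)%:E by exact: cvg_near_cst H.
  exists (Num.bound D^-1) => // N /= DN.
  have := unit_rep_dist N x01; set y := unit_rep _ _ => yx.
  have yD : `|x - y| < D.
    apply: lt_trans yx _; rewrite -[ltRHS]invrK ltf_pV2 ?posrE ?invr_gt0 ?exprn_gt0//.
    exact: upper_nthrootP.
  have cmp c : D <= `|x - c| -> (c < y) = (c < x).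
    move=> /(lt_le_trans yD); rewrite ltr_norml => /andP[y1 y2].
    have [cx|cx] := ltP c x; last first.
      by move: y1 y2; rewrite ler0_norm ?subr_le0// => y1 y2; apply/negbTE; rewrite -leNgt; lra.
    by move: y1 y2; rewrite gtr0_norm ?subr_gt0// => y1 y2; lra.
  case: Dab => Da Db; rewrite /FN -/y /F !indicE; congr (_%:R)%:E; congr nat_of_bool.
  by apply/idP/idP; rewrite !inE/= !in_itv/= cmp// !leNgt cmp.
- apply/integrableP; split; first exact: measurable_cst.
  rewrite (eq_integral (cst 1%E)); last by move=> x _; rewrite /= normr1.
  by rewrite integral_cst ?mul1e; [rewrite [X in (X < _)%E]leb_unit_itv ltry|exact: mU].
- apply: aeW => x N _.
  by rewrite lee_fin /FN /F indicE; case: (_ \in _); rewrite ?normr1 ?normr0.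
by move=> /cvge0_lt-/(_ _ e0)[N FNe]; exists N, (FN N); split=> //; rewrite /L1; under eq_integral do rewrite distrC.
Qed.

Lemma step_approx_bigcup (A : nat -> set R) n : (forall k, step_approx (\1_(A k))) ->
  step_approx (\1_(\bigcup_(k in `I_n) A k)).
Proof.
move=> aA; elim: n => [|n IH].
  rewrite (_ : \1__ = fun=> 0); first exact: (step_approx_step (step_cst 0 0)).
  by apply/funext => x; rewrite indicE memNset// => -[].
rewrite [X in step_approx X](_ : _ = fun x => Num.max (\1_(\bigcup_(k in `I_n) A k) x) (\1_(A n) x)).
  exact: step_approx_max IH (aA n).
apply/funext => x.
rewrite !indicE IIS bigcup_setU bigcup_set1 in_setU.
case: (x \in A n); rewrite ?orbT ?orbF; case: (x \in _); rewrite /= ?mulr1n ?mulr0n ?maxxx //.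
- by rewrite (max_r ler01).
- by rewrite (max_l ler01).
Qed.

Lemma L1_indic (A : set (leb_line R)) : measurable A -> (L1 (\1_A) <= lambda A)%E.
Proof.
move=> mA; rewrite /L1; under eq_integral do rewrite ger0_norm//.
rewrite integral_indic//; last exact: mU.
by rewrite le_measure ?inE//; apply: measurableI => //; exact: mU.
Qed.

(* The completed Lebesgue measure is by construction an outer measure, an infimum over
   countable covers by half-open intervals. *)
Lemma leb_cover (E : set (leb_line R)) (e : R) : measurable E -> (lambda E < +oo)%E -> 0 < e ->
  exists A : nat -> set R, [/\ forall k, exists ab : R * R, A k = [set` `]ab.1, ab.2]],
    E `<=` \bigcup_k A k &
    (\sum_(0 <= k <oo) lambda (A k) < lambda E + e%:E)%E].
Proof.
move=> mE Eoo e0.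
have Efin : lambda E \is a fin_num by rewrite ge0_fin_numE.
have [_ [/= A [mA EA] <-] Ae] := lb_ereal_inf_adherent e0 Efin.
exists A; split => //.
  move=> k; have [ab _ <-] := mA k; by exists ab.
apply: le_lt_trans Ae; apply: lee_nneseries => // k _.
by rewrite -[leRHS](measurable_mu_extE (wlength idfun) (mA k)).
Qed.

(** Regularity: the part of [E] in [0, 1] is covered by intervals [A k] of total length barely
    larger than its measure. On [0, 1] a finite union of them differs from [E] only inside the
    excess [B \ E0] and the tail [T n], both of small measure. *)
Lemma step_approx_indic (E : set (leb_line R)) : measurable E -> step_approx (\1_E).
Proof.
move=> mE; have mI (B : set (leb_line R)) : measurable B -> leb_measurable_fun (\1_B : R -> R).
  by move=> mB; apply: measurable_funTS; exact: measurable_indic.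
apply: step_approx_lim; first exact: mI.
move=> e e0; have e2 : 0 < e / 2 by rewrite divr_gt0.
pose E0 := E `&` U; have mE0 : measurable E0 by apply: measurableI => //; exact: mU.
have E0oo : (lambda E0 < +oo)%E.
  apply: (@le_lt_trans _ _ (lambda U)); last by rewrite leb_unit_itv ltry.
  by apply: le_measure; rewrite ?inE//; [exact: mU|exact: subIsetr].
have [A [Aab EA Ae]] := leb_cover mE0 E0oo e2.
have mA k : measurable (A k : set (leb_line R)).
  by have [ab ->] := Aab k; apply: measurable_leb_line; exact: measurable_itv.
pose B : set (leb_line R) := \bigcup_k A k.
have mB : measurable B by exact: bigcupT_measurable.
pose T n : set (leb_line R) := \bigcup_(k in [set k | (n <= k)%N]) A k.
have mT n : measurable (T n) by exact: bigcup_measurable.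
have sumA : (\sum_(0 <= k <oo) lambda (A k) < +oo)%E.
  by rewrite (lt_trans Ae)// lte_add_pinfty// ltry.
have BE : (lambda (B `\` E0) < (e / 2)%:E)%E.
  have lB : (lambda B < lambda E0 + (e / 2)%:E)%E.
    apply: le_lt_trans Ae; exact: measure_sigma_subadditive.
  rewrite measureD//; last by rewrite (lt_trans lB)// lte_add_pinfty// ltry.
  have -> : B `&` E0 = E0 by apply/setIidr.
  by rewrite lteBlDl// ge0_fin_numE.
have [n Tn] : exists n, (lambda (T n) < (e / 2)%:E)%E.
  have [n hn] := cvge0_lt (nneseries_tail_cvg sumA (fun k _ => measure_ge0 _ _)) e2.
  exists n; apply: le_lt_trans hn; apply: measure_sigma_subadditive_tail => //.
  by move=> x [k /= nk Ak]; exists k => //=; apply/negP; rewrite -leqNgt.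
exists (\1_(\bigcup_(k in `I_n) A k)); split.
  apply: step_approx_bigcup => k; have [ab ->] := Aab k; exact: step_approx_ocitv.
apply: (@le_lt_trans _ _ (L1 (\1_(B `\` E0)) + L1 (\1_(T n)))%E).
  apply: L1_leD.
  - apply: measurable_fun_sub; apply: mI => //.
    by apply: bigcup_measurable.
  - by apply: mI; exact: measurableD.
  - exact: mI.
  - move=> x Ux; rewrite !indicE !normr_nat.
    have [xE|xE] := pselect (E x).
      rewrite [x \in E]mem_set//.
      have [k _ Ak] : B x by apply: EA; split.
      have [kn|nk] := ltnP k n.
        by rewrite [x \in \bigcup_(k in `I_n) A k]mem_set ?subrr ?normr0 ?addr_ge0//; exists k.
      rewrite [x \in T n]mem_set//; last by exists k.
      by case: (x \in _); rewrite /= ?subrr ?subr0 ?normr0 ?normr1 ?lerDr ?addr_ge0.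
    rewrite [x \in E]memNset// sub0r normrN normr_nat.
    have [[k kn Ak]|nA] := pselect ((\bigcup_(k in `I_n) A k) x).
      rewrite [x \in B `\` E0]mem_set; last by split; [exists k|case].
      by rewrite (le_trans (y := 1))// ?lerDl// lern1 leq_b1.
    by rewrite [x \in \bigcup_(k in `I_n) A k]memNset// addr_ge0.
rewrite [X in (_ < X%:E)%E]splitr EFinD.
by apply: lteD; [apply: le_lt_trans BE|apply: le_lt_trans Tn]; apply: L1_indic => //; exact: measurableD.
Qed.

Lemma step_approx_sum (I : Type) (r : seq I) (h : I -> R -> R) :
  (forall i, step_approx (h i)) -> step_approx (fun x => \sum_(i <- r) h i x).
Proof.
move=> ah; elim: r => [|i r IH].
  rewrite (_ : (fun _ => _) = fun=> 0); first exact: (step_approx_step (step_cst 0 0)).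
  by apply/funext => x; rewrite big_nil.
rewrite (_ : (fun _ => _) = fun x => h i x + \sum_(j <- r) h j x).
  exact: step_approxD.
by apply/funext => x; rewrite big_cons.
Qed.

Lemma step_approx_sfun (s : {sfun leb_line R >-> R}) : step_approx (fun x => s (x : leb_line R)).
Proof.
rewrite (_ : (fun _ => _) = fun x : R => \sum_(y <- finmap.enum_fset (fset_set (range s)))
    y * \1_(s @^-1` [set y]) x).
  apply: step_approx_sum => y; apply: step_approxZ; apply: step_approx_indic.
  exact: measurable_sfunP.
by apply/funext => x; rewrite fimfunE fsbig_finite.
Qed.

Lemma step_approx_integrable h : lambda.-integrable U (fun x => (h x)%:E) -> step_approx h.
Proof.
move=> ih; have mh : leb_measurable_fun h.
  by apply/measurable_EFinP; exact: measurable_int ih.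
apply: step_approx_lim => // e e0.
have [g_ [_ _ /cvge0_lt-/(_ _ e0)[n gn]]] := approximation_sfun_integrable mU ih.
exists (g_ n); split; first exact: step_approx_sfun.
exact: gn.
Qed.

Lemma bounded_integrable (M : R) h : leb_measurable_fun h -> (forall x, U x -> `|h x| <= M) ->
  lambda.-integrable U (fun x => (h x)%:E).
Proof.
move=> mh hM; apply: (@le_integrable _ _ _ lambda _ mU _ (fun=> M%:E)).
- exact/measurable_EFinP.
- by move=> x Ux; rewrite /= lee_fin (le_trans (hM x Ux))// ler_norm.
- exact: (integrable_step (step_cst 0 M)).
Qed.

(** [f] need not be integrable without the weight, but its truncations are; they converge to [f] in
    the weighted norm by domination, and [mu <= 1] makes an unweighted approximation of a truncation
    sufficient. *)
Lemma weighted_step_dense (mu f : R -> R) (e : R) : weight_function mu ->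
  in_weighted_L1 mu f -> 0 < e -> exists N F, step N F /\
  (\int[lambda]_(x in U) (`|f x - F x| * mu x)%:E < e%:E)%E.
Proof.
move=> [mmu mu01] [mf fmu] e0; have e2 : 0 < e / 2 by rewrite divr_gt0.
pose clip n x := Num.max (- n%:R) (Num.min (f x) n%:R).
have mclip n : leb_measurable_fun (clip n).
  by apply: measurable_maxr; [exact: measurable_cst|apply: measurable_minr].
have clipM n x : `|clip n x| <= n%:R.
  rewrite ler_norml /clip le_max lexx/= ge_max ge_min lexx orbT andbT.
  by rewrite (@le_trans _ _ 0) ?oppr_le0.
have mP h : leb_measurable_fun h -> measurable_fun U (fun x : leb_line R => (`|h x| * mu x)%:E).
  move=> mh; have mn : leb_measurable_fun (fun x => `|h x|) by exact: measurableT_comp.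
  by apply/measurable_EFinP; exact: (measurable_funM mn mmu).
have [|||||_ + _] := @dominated_convergence _ _ _ lambda U mU
    (fun n x => (`|f x - clip n x| * mu x)%:E) (cst 0%E) (fun x => (`|f x| * mu x)%:E).
- by move=> n; apply: mP; exact: measurable_fun_sub.
- exact: measurable_cst.
- apply: aeW => x Ux.
  suff H : \forall n \near \oo, (`|f x - clip n x| * mu x)%:E = 0%E by exact: cvg_near_cst H.
  exists (Num.bound `|f x|) => // n /= fn.
  have fn' : `|f x| <= n%:R.
    by rewrite (le_trans (ltW (archi_boundP (normr_ge0 _))))// ler_nat.
  move: fn'; rewrite ler_norml => /andP[n1 n2].
  by rewrite /clip min_l// max_r// subrr normr0 mul0r.
- apply/integrableP; split; first exact: mP.
  apply: le_lt_trans fmu; rewrite le_eqVlt; apply/orP; left; apply/eqP.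
  apply: eq_integral => x; rewrite inE => Ux.
  by rewrite abse_EFin ger0_norm// mulr_ge0//; case/andP: (mu01 x Ux) => /ltW.
- apply: aeW => x n Ux; have [/ltW mu0 _] := andP (mu01 x Ux).
  rewrite /= lee_fin ger0_norm ?mulr_ge0// ler_wpM2r//.
  have n0 : 0 <= n%:R :> R by [].
  rewrite /clip; have [h1|h1] := leP (f x) n%:R; last first.
    by rewrite max_r ?(le_trans _ n0) ?oppr_le0// !ger0_norm; lra.
  have [h2|h2] := leP (- n%:R) (f x); first by rewrite subrr normr0.
  by rewrite !ler0_norm; lra.
move=> /cvge0_lt-/(_ _ e2)[n cn].
have [_ ac] := step_approx_integrable (bounded_integrable (mclip n) (fun x _ => clipM n x)).
have [N [F [sF l1]]] := ac _ e2; exists N, F; split=> //.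
apply: (@le_lt_trans _ _ (\int[lambda]_(x in U) (`|f x - clip n x| * mu x)%:E +
   L1 (fun x => clip n x - F x)%R)%E).
  have m1 := mP _ (measurable_fun_sub mf (mclip n)).
  have m2 := measurable_normE (measurable_fun_sub (mclip n) (measurable_step sF)).
  rewrite /L1 -(ge0_integralD _ mU _ m1 _ m2); first last.
  - by move=> x _; rewrite lee_fin.
  - by move=> x Ux; rewrite lee_fin mulr_ge0//; case/andP: (mu01 x Ux) => /ltW.
  apply: ge0_le_integral; first exact: mU.
  - by move=> x Ux; rewrite lee_fin mulr_ge0//; case/andP: (mu01 x Ux) => /ltW.
  - exact: mP (measurable_fun_sub mf (measurable_step sF)).
  - exact: emeasurable_funD.
  - move=> x Ux; have [/ltW mu0 mu1] := andP (mu01 x Ux).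
    rewrite -EFinD lee_fin -[X in `|X|](subrKA (clip n x)).
    have h1 := ler_normD (f x - clip n x) (clip n x - F x).
    apply: (le_trans (ler_wpM2r mu0 h1)); rewrite mulrDl lerD2l.
    by rewrite ler_piMr.
rewrite [X in (_ < X%:E)%E]splitr EFinD; apply: lteD => //.
move: cn; rewrite /=; apply: le_lt_trans; rewrite le_eqVlt; apply/orP; left; apply/eqP.
apply: eq_integral => x; rewrite inE => Ux; have [/ltW mu0 _] := andP (mu01 x Ux).
by rewrite subr0 normrM normr_id (ger0_norm mu0).
Qed.

End Density.

(** * Series of functions and completeness of L1 *)

Section Series.
Context {R : realType}.
Implicit Types (F G h : R -> R) (x y : R) (N M k m s : nat).

Notation lambda := (leb R).
Notation U := (unit_itv R).
Local Notation mU := (@measurable_unit_itv R).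

Definition eseries (a : nat -> R) : \bar R := (\sum_(0 <= s <oo) (a s)%:E)%E.

(* Equal to 0 when the series diverges. *)
Definition tsum (a : nat -> R) : R := fine (eseries a).

Lemma eseriesE (a : nat -> R) : (forall s, 0 <= a s) -> (eseries a < +oo)%E ->
  eseries a = (tsum a)%:E.
Proof.
move=> a0 aoo; rewrite fineK// ge0_fin_numE//.
by apply: nneseries_ge0 => n _ _; rewrite lee_fin.
Qed.

Lemma tsum_ge0 (a : nat -> R) : (forall s, 0 <= a s) -> 0 <= tsum a.
Proof.
by move=> a0; apply: fine_ge0; apply: nneseries_ge0 => n _ _; rewrite lee_fin.
Qed.

Lemma sum_le_tsum (a : nat -> R) m : (forall s, 0 <= a s) -> (eseries a < +oo)%E ->
  \sum_(0 <= s < m) a s <= tsum a.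
Proof.
move=> a0 aoo; rewrite -lee_fin -(eseriesE a0 aoo) -sumEFin.
by apply: (@nneseries_lim_ge _ _ xpredT) => n _ _; rewrite lee_fin.
Qed.

Lemma cvg_tsum (a : nat -> R) : (forall s, 0 <= a s) -> (eseries a < +oo)%E ->
  \sum_(0 <= s < m) a s @[m --> \oo] --> tsum a.
Proof.
move=> a0 aoo; rewrite [X in X @ _](_ : _ = fine \o (fun m => \sum_(0 <= s < m) (a s)%:E)%E).
  apply: fine_cvg; rewrite -(eseriesE a0 aoo).
  by apply: (@is_cvg_nneseries _ _ xpredT) => n _ _; rewrite lee_fin.
by apply/funext => m; rewrite /= sumEFin.
Qed.

Lemma summable_tail (a : nat -> R) : (forall s, 0 <= a s) -> (eseries a < +oo)%E ->
  forall e, 0 < e -> exists s1, forall s, \sum_(s1 <= j < s) a j <= e.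
Proof.
move=> a0 aoo e e0; have /cvgrPdist_lt/(_ _ e0)[s1 _ h] := cvg_tsum a0 aoo.
exists s1 => s; have := h _ (leqnn s1); rewrite ger0_norm ?subr_ge0 ?sum_le_tsum// => h1.
have [ss|ss] := leqP s1 s; last by rewrite (big_geq (ltnW ss)) ltW.
have := sum_le_tsum s a0 aoo; rewrite (@big_cat_nat _ _ _ s1)//= => h2; lra.
Qed.

Lemma summable_cvg0 (a : nat -> R) : (forall s, 0 <= a s) -> (eseries a < +oo)%E ->
  a @ \oo --> 0.
Proof.
move=> a0 aoo; apply/cvgrPdist_le => e e0; have [s1 h] := summable_tail a0 aoo e0.
exists s1 => // s /= s1s; rewrite sub0r normrN ger0_norm//.
by apply: le_trans (h s.+1); rewrite big_nat_recr//= lerDr sumr_ge0.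
Qed.

Lemma eseries_pow2 : (eseries (fun s => 2 ^- s) < +oo :> \bar R)%E.
Proof.
apply: (@le_lt_trans _ _ 2%:E); last exact: ltry.
apply: le_trans (epsilon_trick0 xpredT (ler0n R 2)).
rewrite le_eqVlt; apply/orP; left; apply/eqP; apply: eq_eseriesr => s _.
by rewrite natrX exprS invfM mulrA divff// mul1r.
Qed.

Lemma eseries_le (a b : nat -> R) : (forall s, 0 <= a s <= b s) ->
  (eseries b < +oo)%E -> (eseries a < +oo)%E.
Proof.
move=> ab; apply: le_lt_trans; apply: lee_nneseries => s _ *; rewrite lee_fin.
  by case/andP: (ab s).
by case/andP: (ab s).
Qed.

Lemma measurable_tsum (a : nat -> R -> R) : (forall s, leb_measurable_fun (a s)) ->
  (forall s x, U x -> 0 <= a s x) -> leb_measurable_fun (fun x => tsum (a ^~ x)).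
Proof.
move=> ma a0; apply: measurableT_comp; first exact: fine_measurable.
apply: ge0_emeasurable_sum => [k x Ux _|k _]; first by rewrite lee_fin a0.
by apply/measurable_EFinP; exact: ma.
Qed.

Lemma ae_summable (a : nat -> R -> R) : (forall s, leb_measurable_fun (a s)) ->
  (forall s x, U x -> 0 <= a s x) ->
  (\sum_(0 <= s <oo) \int[lambda]_(x in U) (a s x)%:E < +oo)%E ->
  [/\ lambda.-integrable U (fun x => (tsum (a ^~ x))%:E) &
      {ae lambda, forall x, U x -> (eseries (a ^~ x) < +oo)%E}].
Proof.
move=> ma a0 aoo.
have mf s : measurable_fun U (fun x : leb_line R => (a s x)%:E).
  by apply/measurable_EFinP; exact: ma.
have f0 s (x : leb_line R) : U x -> (0 <= (a s x)%:E)%E by move=> Ux; rewrite lee_fin a0.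
have mE : measurable_fun U (fun x : leb_line R => eseries (a ^~ x)).
  by apply: ge0_emeasurable_sum => [k x Ux _|k _]; [exact: f0|exact: mf].
have E0 x : U x -> (0 <= eseries (a ^~ x))%E.
  by move=> Ux; apply: nneseries_ge0 => n _ _; exact: f0.
have iE : lambda.-integrable U (fun x => eseries (a ^~ x)).
  apply/integrableP; split=> //; apply: le_lt_trans aoo.
  rewrite -(integral_nneseries _ mU mf f0) le_eqVlt; apply/orP; left; apply/eqP.
  by apply: eq_integral => x; rewrite inE => Ux; rewrite gee0_abs// E0.
split; last first.
  apply: aeS (integrable_ae mU iE) => x h Ux; have := h Ux.
  by rewrite ge0_fin_numE// E0.
apply: (le_integrable mU _ _ iE).
  by apply/measurable_EFinP; exact: measurable_tsum.
move=> x Ux; rewrite /tsum; have := E0 x Ux; case: (eseries _) => //=.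
by move=> _; exact: leey.
Qed.

(** Completeness of L1 for absolutely convergent series. [tsum] handles nonnegative terms, so [F] is
    split as [(|F| + F) - |F|]; the sum of the [|F s|] is finite almost everywhere and dominates the
    partial sums. *)
Lemma L1_series (F : nat -> R -> R) : (forall s, leb_measurable_fun (F s)) ->
  (\sum_(0 <= s <oo) L1 (F s) < +oo)%E ->
  exists g, lambda.-integrable U (fun x => (g x)%:E) /\
    L1 (fun x => \sum_(0 <= s < m) F s x - g x)%R @[m --> \oo] --> 0%E.
Proof.
move=> mF Foo.
pose a s x := `|F s x|; pose b s x := `|F s x| + F s x.
have ma s : leb_measurable_fun (a s) by apply: measurableT_comp; [|exact: mF].
have mb s : leb_measurable_fun (b s) by exact: (measurable_funD (ma s) (mF s)).
have a0 s x : 0 <= a s x by rewrite /a.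
have b0 s x : 0 <= b s x by rewrite /b; have := ler_norm (- F s x); rewrite normrN; lra.
have b2 s x : b s x <= 2 * a s x.
  by rewrite /b /a; have := ler_norm (F s x); lra.
have [ia ae_a] := ae_summable ma (fun s x _ => a0 s x) Foo.
pose g x := tsum (b ^~ x) - tsum (a ^~ x).
have mg : leb_measurable_fun g.
  by apply: measurable_fun_sub; apply: measurable_tsum.
have ptw x : (eseries (a ^~ x) < +oo)%E ->
    \sum_(0 <= s < m) F s x @[m --> \oo] --> g x.
  move=> aoo; have boo : (eseries (b ^~ x) < +oo)%E.
    apply: (@eseries_le _ (fun s => 2 * a s x)) => [s|]; first by rewrite b0 b2.
    rewrite /eseries; under eq_eseriesr do rewrite EFinM.
    rewrite nneseriesZl//; last by move=> s _; rewrite lee_fin.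
    by rewrite lte_mul_pinfty// lee_fin.
  rewrite [X in X @ _](_ : _ = fun m => \sum_(0 <= s < m) b s x - \sum_(0 <= s < m) a s x).
    exact: cvgB (cvg_tsum (b0 ^~ x) boo) (cvg_tsum (a0 ^~ x) aoo).
  apply/funext => m; rewrite -sumrB.
  by apply: eq_bigr => s _; rewrite /b /a addrAC subrr add0r.
have mS m : leb_measurable_fun (fun x => \sum_(0 <= s < m) F s x).
  elim: m => [|m IH].
    have -> : (fun x => \sum_(0 <= s < 0) F s x) = fun=> 0.
      by apply/funext => x; rewrite big_geq.
    exact: measurable_cst.
  have -> : (fun x => \sum_(0 <= s < m.+1) F s x) =
      fun x => \sum_(0 <= s < m) F s x + F m x.
    by apply/funext => x; rewrite big_nat_recr.
  exact: (measurable_funD IH (mF m)).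
have [|||||ig + _] := @dominated_convergence _ _ _ lambda U mU
    (fun m x => (\sum_(0 <= s < m) F s x)%:E) (fun x => (g x)%:E) (fun x => (tsum (a ^~ x))%:E).
- by move=> m; apply/measurable_EFinP; exact: mS.
- exact/measurable_EFinP.
- apply: aeS ae_a => x h Ux; have gx := ptw x (h Ux).
  by apply/fine_cvgP; split; [exact: nearW|exact: gx].
- exact: ia.
- apply: aeS ae_a => x h m Ux; rewrite lee_fin (le_trans (ler_norm_sum _ _ _))//.
  by apply: sum_le_tsum => //; exact: h.
by move=> g0; exists g; split=> //; exact: g0.
Qed.

End Series.

(** * Walsh functions and coefficients up to null sets *)

Section WalshAE.
Context {R : realType}.
Implicit Types (F G h : R -> R) (x y : R) (N M k m s n j : nat).

Notation lambda := (leb R).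
Notation U := (unit_itv R).
Local Notation mU := (@measurable_unit_itv R).

Lemma ae_nondyadic :
  {ae lambda, forall x : leb_line R, forall n j, x <> j%:R / 2 ^+ n :> R}.
Proof. by apply: ae_foralln => n; apply: ae_foralln => j; exact: ae_neq. Qed.

Lemma sin_add_natpi (a : R) j : sin (a + j%:R * pi) = (-1) ^+ j * sin a.
Proof. by rewrite mulr_natl (alternatingn (@sinDpi R)). Qed.

Lemma rademacher_rad n x : 0 <= x -> (forall j, x <> j%:R / 2 ^+ n) ->
  rademacher n x = rad n x.
Proof.
move=> x0 nd; rewrite /rademacher /rad /bit.
have p0 : 0 < (2 ^+ n : R) by rewrite exprn_gt0.
set z := 2 ^+ n * x; have z0 : 0 <= z by rewrite mulr_ge0// ltW.
have := truncn_itv z0; set t := Num.truncn z => /andP[tz zt].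
have {}tz : t%:R < z.
  rewrite lt_neqAle tz andbT; apply/eqP => e; apply: (nd t).
  by rewrite e /z mulrAC divff ?mul1r// gt_eqF.
rewrite (_ : 2 ^+ n * pi * x = (z - t%:R) * pi + t%:R * pi); last first.
  by rewrite /z; ring.
rewrite sin_add_natpi sgrM.
have -> : Num.sg (sin ((z - t%:R) * pi)) = 1.
  apply/gtr0_sg/sin_gt0_pi; rewrite mulr_gt0 ?subr_gt0 ?pi_gt0//=.
  rewrite gtr_pMl ?pi_gt0// ltrBlDr.
  by move: zt; rewrite -natr1 addrC.
by rewrite mulr1 -signr_odd; case: (odd t); rewrite ?expr0 ?expr1 ?sgrN ?sgr1.
Qed.

Lemma walsh_ae : {ae lambda, forall x : leb_line R, U x -> forall k, walsh k x = wal k x}.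
Proof.
apply: aeS ae_nondyadic => x nd /andP[x0 _] k.
by apply: eq_bigr => i _; apply: rademacher_rad.
Qed.

(** This rests on the completeness of the measure, and transfers measurability from [wal] to
    [walsh], which agrees with it only almost everywhere. *)
Lemma ae_leb_measurable F G : {ae lambda, forall x : leb_line R, U x -> F x = G x} ->
  leb_measurable_fun F -> leb_measurable_fun G.
Proof.
move=> FG /measurable_EFinP mF; apply/measurable_EFinP.
apply: (ae_measurable_fun completed_lebesgue_measure_is_complete _ mF).
by apply: aeS FG => x h Ux /=; rewrite h.
Qed.

Lemma measurable_wal k : leb_measurable_fun (wal k : R -> R).
Proof.
apply: (@measurable_step _ k); apply: step_wal; exact: ltn_expl.
Qed.

Lemma measurable_walsh k : leb_measurable_fun (walsh k : R -> R).
Proof.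
apply: ae_leb_measurable (measurable_wal k).
by apply: aeS walsh_ae => x h Ux; rewrite h.
Qed.

Lemma walsh_coef_wal (g : R -> R) k : leb_measurable_fun g ->
  walsh_coef g k = mean (fun x => g x * wal k x).
Proof.
move=> mg; rewrite /walsh_coef /mean /Rintegral; congr fine.
apply: ae_eq_integral; first exact: mU.
- by apply/measurable_EFinP; exact: (measurable_funM mg (measurable_walsh k)).
- by apply/measurable_EFinP; exact: (measurable_funM mg (measurable_wal k)).
- by apply: aeS walsh_ae => x h Ux; rewrite h.
Qed.

(** As [wal k] is unimodular, the k-th coefficients of two functions differ by at most their L1
    distance; [m <= p m] ensures that all long enough sums contain the frequency [k]. *)
Lemma walsh_coef_lim (c : nat -> R) (p : nat -> nat) (g : R -> R) k :
  lambda.-integrable U (fun x => (g x)%:E) -> (forall m, (m <= p m)%N) ->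
  L1 (fun x => wsum c (p m) x - g x)%R @[m --> \oo] --> 0%E -> walsh_coef g k = c k.
Proof.
move=> ig pm lim; have mg : leb_measurable_fun g.
  by apply/measurable_EFinP; exact: measurable_int ig.
rewrite walsh_coef_wal//; apply/eqP; rewrite -subr_eq0 -normr_eq0; apply/eqP.
apply/le_anti; rewrite normr_ge0 andbT; apply/ler_addgt0Pl => e e0; rewrite addr0.
have [m0 _ hm0] := cvge0_near lim e0; pose m := maxn m0 k.+1.
have {hm0} := hm0 m (leq_maxl _ _); set P := wsum c (p m) => hm /=.
have kp : (k < p m)%N by apply: leq_trans (pm m); rewrite /m; lia.
have sP : step (p m) P by apply: step_wsum; apply/ltnW; exact: ltn_expl.
have mP : leb_measurable_fun P := measurable_step sP.
have iP := integrable_step sP.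
have iPg : lambda.-integrable U (fun x => (P x - g x)%:E).
  by have := integrableB mU iP ig; apply: eq_integrable => //; exact: mU.
have mul_wal F : lambda.-integrable U (fun x => (F x)%:E) ->
    lambda.-integrable U (fun x => (F x * wal k x)%:E).
  move=> iF; have mF : leb_measurable_fun F.
    by apply/measurable_EFinP; exact: measurable_int iF.
  apply: (le_integrable mU _ _ iF).
    by apply/measurable_EFinP; exact: (measurable_funM mF (measurable_wal k)).
  by move=> x _; rewrite lee_fin normrM abs_wal mulr1.
have -> : c k = mean (fun x => P x * wal k x) by rewrite mean_wsum kp.
rewrite distrC /mean -RintegralB; first last.
- exact: mul_wal.
- exact: mul_wal.
- exact: mU.
have iD : lambda.-integrable U (EFin \o (fun x => P x * wal k x - g x * wal k x)).
  have := integrableB mU (mul_wal _ iP) (mul_wal _ ig).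
  by apply: eq_integrable => //; exact: mU.
apply: (le_trans (le_normr_Rintegral mU iD)); rewrite /Rintegral.
rewrite (_ : (\int[lambda]_(x in U) _)%E = L1 (fun x => P x - g x)).
  rewrite -lee_fin fineK ?ltW// ge0_fin_numE ?(lt_trans hm) ?ltry//.
  by apply: integral_ge0 => x _; rewrite lee_fin.
by apply: eq_integral => x _; rewrite -mulrBl normrM abs_wal mulr1.
Qed.

End WalshAE.

(** * Tracking the target *)

Section Tracking.
Context {R : realType}.
Implicit Types (k m s j : nat).

Lemma eseries_le_bound (a : nat -> R) (B : R) : (forall s, 0 <= a s) ->
  (forall m, \sum_(0 <= s < m) a s <= B) -> (eseries a <= B%:E)%E.
Proof.
move=> a0 aB; apply: lime_le.
  by apply: (@is_cvg_nneseries _ _ xpredT) => n _ _; rewrite lee_fin.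
by apply: nearW => m; rewrite sumEFin lee_fin.
Qed.

Lemma eseries_bounded (a : nat -> R) (B : R) : (forall s, 0 <= a s) ->
  (forall m, \sum_(0 <= s < m) a s <= B) -> (eseries a < +oo)%E.
Proof. by move=> a0 aB; exact: le_lt_trans (eseries_le_bound a0 aB) (ltry _). Qed.

Lemma tsum_le_bound (a : nat -> R) (B : R) : (forall s, 0 <= a s) ->
  (forall m, \sum_(0 <= s < m) a s <= B) -> tsum a <= B.
Proof.
move=> a0 aB; rewrite -lee_fin -eseriesE//; first exact: eseries_le_bound.
exact: eseries_bounded aB.
Qed.

(* Moves on to the next approximant only when its rank fits the current stage. *)
Definition slow_index (r n : nat -> nat) : nat -> nat :=
  fix kk s := if s is s'.+1 then
    (if (r (kk s').+1 <= n s'.+1)%N then (kk s').+1 else kk s') else 0%N.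

Lemma slow_index_rank (r n : nat -> nat) s : r 0%N = 0%N ->
  (forall s, (n s <= n s.+1)%N) -> (r (slow_index r n s) <= n s)%N.
Proof.
move=> r0 nS; elim: s => [|s IH] /=; first by rewrite r0.
by case: ifP => // _; exact: leq_trans (nS s).
Qed.

Lemma slow_index_unbounded (r n : nat -> nat) K : (forall s, (s <= n s)%N) ->
  exists s0, forall s, (s0 <= s)%N -> (K <= slow_index r n s)%N.
Proof.
move=> ns; elim: K => [|K [s0 IH]]; first by exists 0%N.
pose s1 := maxn s0 (r K.+1); exists s1.+1 => -[//|s]; rewrite ltnS => s1s.
have s0s : (s0 <= s)%N by apply: leq_trans s1s; exact: leq_maxl.
have rs : (r K.+1 <= n s.+1)%N.
  by apply: leq_trans (ns _); apply: leqW; apply: leq_trans s1s; exact: leq_maxr.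
have /= := IH s s0s; rewrite leq_eqVlt => /predU1P[<-|Ks]; first by rewrite rs.
by case: ifP => // _; exact: leq_trans Ks _.
Qed.

(** The index rises by at most one at a time, so the k-th approximant is entered once and left once,
    at a cost of [w k] each; the current one has not been left, hence its single [w]. *)
Lemma tracking_variation (w phi : nat -> R) (f : R) (r n : nat -> nat) s :
  (forall k, w k = `|phi k - f|) ->
  \sum_(0 <= j < s) `|phi (slow_index r n j.+1) - phi (slow_index r n j)| <=
    2 * \sum_(0 <= k < slow_index r n s) w k + w (slow_index r n s).
Proof.
move=> wE; elim: s => [|s IH]; first by rewrite !big_geq//= wE mulr0 add0r.
rewrite big_nat_recr//=; set K := slow_index r n s in IH *.
case: ifP => _; last by rewrite subrr normr0 addr0.
rewrite big_nat_recr//= (le_trans (lerD IH (lexx _)))//.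
have : `|phi K.+1 - phi K| <= w K.+1 + w K.
  rewrite !wE -[X in `|X|](subrKA f) (le_trans (ler_normD _ _))//.
  by rewrite [`|f - _|]distrC.
by set X := \sum_(_ <= _ < _) _; lra.
Qed.

Definition steer_sign (S f : R) : R := if S <= f then 1 else -1.

Lemma steer_sign_sq (S f : R) : steer_sign S f * steer_sign S f = 1.
Proof. by rewrite /steer_sign; case: ifP => _; rewrite ?mulr1// mulrNN mulr1. Qed.

Section Track.
Variables (S b phi : nat -> R) (f : R) (r n : nat -> nat).
Let kk := slow_index r n.
Let w k := `|phi k - f|.
Hypothesis S0 : S 0%N = 0.
Hypothesis phi0 : phi 0%N = 0.
Hypothesis b01 : forall s, b s = 0 \/ b s = 1.
Hypothesis SS : forall s, S s.+1 =
  S s + steer_sign (S s) (phi (kk s)) * @harmonic R s * (1 - 2 ^+ s * b s).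
Hypothesis woo : (eseries w < +oo)%E.

Let w0 k : 0 <= w k. Proof. exact: normr_ge0. Qed.
Let d j := `|phi (kk j.+1) - phi (kk j)|.

Let d_bound s : \sum_(0 <= j < s) d j <= 2 * tsum w.
Proof.
apply: le_trans (tracking_variation r n s (fun k => erefl (w k))) _.
have := sum_le_tsum (slow_index r n s).+1 w0 woo; rewrite big_nat_recr//=.
by have := w0 (slow_index r n s); lra.
Qed.

(** Valid at every stage, lost bets included; times the weight it yields the dominating function.
    The motion of the target costs [2 * tsum w], its distance to [f] another [tsum w]. *)
Lemma track_bound s : `|S s - f| <= 1 + \sum_(0 <= j < s) 2 ^+ j * b j + 3 * tsum w.
Proof.
have u_bound : `|S s - phi (kk s)| <= 1 + \sum_(0 <= j < s) (2 ^+ j * b j + d j).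
  elim: s => [|s IH]; first by rewrite /= S0 phi0 subrr normr0 big_geq// addr0.
  rewrite big_nat_recr//= addrA SS.
  set u := S s - phi (kk s) in IH; set X := \sum_(_ <= _ < _) _ in IH *.
  set g := harmonic s; set t := 2 ^+ s * b s.
  have g0 : 0 <= g by exact: harmonic_ge0.
  have g1 : g <= 1 by rewrite invf_le1 ?ler1n.
  have t0 : 0 <= t by rewrite mulr_ge0 ?exprn_ge0//; case: (b01 s) => ->.
  have X0 : 0 <= X.
    apply: sumr_ge0 => j _; rewrite addr_ge0 ?normr_ge0// mulr_ge0 ?exprn_ge0//.
    by case: (b01 j) => ->.
  rewrite (_ : S s + _ - _ = (u + steer_sign (S s) (phi (kk s)) * g
     - steer_sign (S s) (phi (kk s)) * g * t) - (phi (kk s.+1) - phi (kk s))); last first.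
    by rewrite /u; ring.
  rewrite (le_trans (ler_normB _ _))// [leRHS]addrA lerD//.
  rewrite (le_trans (ler_normB _ _))// lerD//.
    (* A move of length [g <= 1] towards 0 cannot leave an interval around 0 of radius at least
       1. *)
    have : u <= 0 \/ 0 <= u by case: (leP u 0) => [|/ltW]; [left|right].
    rewrite /steer_sign -(subr_le0 (phi (kk s))) -/u.
    move: IH; rewrite !ler_norml => /andP[i1 i2] _.
    by case: (leP u 0) => hu; apply/andP; split; lra.
  rewrite [`|_ * t|]normrM [`|_ * g|]normrM (ger0_norm g0) (ger0_norm t0).
  have -> : `|steer_sign (S s) (phi (kk s))| = 1.
    by rewrite /steer_sign; case: ifP; rewrite ?normrN1 ?normr1.
  by rewrite mul1r ler_piMl.
have wk : w (kk s) <= tsum w.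
  apply: le_trans (sum_le_tsum (kk s).+1 w0 woo).
  by rewrite big_nat_recr//= lerDr sumr_ge0.
rewrite -(subrKA (phi (kk s))) (le_trans (ler_normD _ _))//.
move: u_bound; rewrite big_split /= => u_bound.
have := d_bound s; have : `|phi (kk s) - f| <= tsum w := wk.
by move: u_bound; set X := \sum_(_ <= _ < _) _; set Y := \sum_(_ <= _ < _) _; lra.
Qed.

Lemma track_cvg : (forall s, (s <= n s)%N) -> b @ \oo --> 0 -> S @ \oo --> f.
Proof.
move=> ns b_cvg.
(* A sequence of values 0 and 1 that tends to 0 is eventually 0. From then on every increment is
   exactly [harmonic s] in the chosen direction, and [steering] applies. *)
have [s0 b0] : exists s0, forall s, (s0 <= s)%N -> b s = 0.
  have /cvgrPdist_lt/(_ _ ltr01)[s0 _ h] := b_cvg; exists s0 => s /h /=.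
  by rewrite sub0r normrN; case: (b01 s) => -> //; rewrite normr1 ltxx.
have u_cvg : (fun s => S s - phi (kk s)) @ \oo --> 0.
  apply: (@steering _ _ d s0) => [s||s ss]; first exact: normr_ge0.
    move=> e e0; apply: summable_tail => //; first by move=> s; exact: normr_ge0.
    by apply: (@eseries_bounded _ (2 * tsum w)) => // s; exact: normr_ge0.
  rewrite SS b0// mulr0 subr0 mulr1.
  set u := S s - phi (kk s); set g := harmonic s.
  have g0 : 0 <= g by exact: harmonic_ge0.
  rewrite (_ : S s + _ - _ = (u + steer_sign (S s) (phi (kk s)) * g)
     - (phi (kk s.+1) - phi (kk s))); last by rewrite /u; ring.
  rewrite (le_trans (ler_normB _ _))// lerD//.
  rewrite /steer_sign -(subr_le0 (phi (kk s))) -/u le_max.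
  case: (leP u 0) => hu; rewrite ?mul1r ?mulN1r.
    rewrite (ler0_norm hu); case: (leP 0 (u + g)) => h; apply/orP.
      by right; rewrite (ger0_norm h); lra.
    by left; rewrite (ltr0_norm h); lra.
  rewrite (gtr0_norm hu); case: (leP 0 (u - g)) => h; apply/orP.
    by left; rewrite (ger0_norm h); lra.
  by right; rewrite (ltr0_norm h); lra.
have w_cvg : (fun s => phi (kk s) - f) @ \oo --> 0.
  apply/cvgrPdist_le => e e0.
  have /cvgrPdist_le/(_ _ e0)[K _ hK] := summable_cvg0 w0 woo.
  have [s1 h1] := slow_index_unbounded r K ns; exists s1 => // s /= s1s.
  have /= := hK _ (h1 _ s1s); by rewrite !sub0r !normrN /w normr_id.
have E : (fun s => S s - phi (kk s) + (phi (kk s) - f) + f) = S.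
  by apply/funext => s; ring.
by have := cvgD (cvgD u_cvg w_cvg) (cvg_cst f); rewrite !add0r -[X in _ -> X @ _ --> _]E; exact.
Qed.

End Track.
End Tracking.

(** * The universal function and its weight *)

Section TotalCoefficients.
Context {R : realType}.
Implicit Types (F G h : R -> R) (x y : R) (N M k m s : nat).
Variable n : nat -> nat.
Hypothesis n0 : n 0%N = 0%N.
Hypothesis nS : forall s, (n s < n s.+1)%N.

Lemma block_end_ge s : (s <= n s)%N.
Proof. by elim: s => // s IH; exact: leq_ltn_trans IH (nS s). Qed.

Lemma block_end_le s s' : (s <= s')%N -> (n s <= n s')%N.
Proof.
by move=> ss; apply: (homo_leq (leqnn) leq_trans) ss => i; exact: ltnW.
Qed.

Lemma find_block k : (0 < k)%N -> exists s, (2 ^ n s <= k < 2 ^ n s.+1)%N.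
Proof.
move=> k0; have [m] : exists m, (k < 2 ^ n m)%N.
  by exists k; exact: leq_ltn_trans (block_end_ge k) (ltn_expl _ _).
elim: m => [|m IH]; first by rewrite n0 expn0; case: k k0.
by have [/IH|mk km] := ltnP k (2 ^ n m); last by exists m; rewrite mk.
Qed.

Variables (c d : nat -> nat -> R).
Hypothesis B : forall s, block (n s) (n s.+1) (c s) (d s).

(** Summing up to [s = k] loses nothing: if [k] lies in the block [s], then
    [s <= n s < 2 ^ n s <= k]. The frequency 0 lies in no block, because [n 0 = 0]. *)
Definition total (e : nat -> nat -> R) k : R := \sum_(0 <= s < k.+1) e s k.

Lemma total_block s k : (2 ^ n s <= k < 2 ^ n s.+1)%N -> total d k = d s k.
Proof.
move=> /andP[sk ks]; rewrite /total (bigD1_seq s) ?iota_uniq//=; last first.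
  rewrite mem_index_iota ltnS/=.
  exact: leq_trans (block_end_ge s) (ltnW (leq_trans (ltn_expl _ (ltnSn 1)) sk)).
rewrite big1_seq ?addr0// => s' /andP[s's _].
apply: (block_d0 (B s')); have [ss|ss] := ltnP s' s.
  by rewrite orbC (leq_trans _ sk)// leq_exp2l// block_end_le.
have {}ss : (s < s')%N by rewrite ltn_neqAle eq_sym s's.
by rewrite (leq_trans ks)// leq_exp2l// block_end_le.
Qed.

Lemma total0 : total d 0 = 0.
Proof. by rewrite /total big_nat1 (block_d0 (B 0%N))// n0. Qed.

Lemma total_partial s m x : (2 ^ n s <= m <= 2 ^ n s.+1)%N ->
  wsum (total d) m x = wsum (total d) (2 ^ n s) x + wsum (d s) m x.
Proof.
move=> /andP[sm ms]; rewrite (wsum_cat _ _ sm); congr (_ + _).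
rewrite (wsum_cat _ _ sm) (block_sum0 _ (B s))// add0r.
apply: eq_big_nat => k /andP[sk km]; rewrite (@total_block s)//.
by rewrite sk (leq_trans km ms).
Qed.

Lemma total_full s x : wsum (total d) (2 ^ n s) x =
  \sum_(0 <= j < s) wsum (d j) (2 ^ n j.+1) x.
Proof.
elim: s => [|s IH]; first by rewrite big_geq// n0 expn0 /wsum big_nat1 total0 mul0r.
rewrite big_nat_recr//= -IH (@total_partial s)// leqnn andbT leq_exp2l//.
exact: ltnW.
Qed.

End TotalCoefficients.

(** * The stages, the weight and the choice of signs *)

Section Universality.
Context {R : realType}.
Implicit Types (F G h : R -> R) (x y : R) (N M k m s : nat).

Notation lambda := (leb R).
Notation U := (unit_itv R).
Local Notation mU := (@measurable_unit_itv R).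

Definition stage_spec n M s (c : nat -> R) (b : R -> R) : Prop :=
  [/\ (n < M)%N /\ block n M c c, step M b /\ (forall x, b x = 0 \/ b x = 1),
      mean (fun x => `|wsum c (2 ^ M) x|) <= 2 ^- s, mean b = 2 ^- s &
      forall sg : R -> R, step n sg -> (forall x, sg x * sg x = 1) -> exists d,
      [/\ block n M c d,
          forall x, wsum d (2 ^ M) x = sg x * @harmonic R s * (1 - 2 ^+ s * b x) &
          forall m, mean (fun x => `|wsum d m x|) <= 8 * @harmonic R s]].

Lemma stage_exists n s : exists r : nat * (nat -> R) * (R -> R),
  stage_spec n r.1.1 s r.1.2 r.2.
Proof.
have h0 : 0 < @harmonic R s by exact: harmonic_gt0.
(* The bound [2 ^- s] is for the integrability of the universal function; the bound [harmonic s]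
   turns [7 * harmonic s + eta] into [8 * harmonic s]. *)
have e0 : 0 < Num.min (2 ^- s) (@harmonic R s) by rewrite lt_min h0 invr_gt0 exprn_gt0.
have [M [c [b [sb b01 mc mb Hd]]]] := stage n s h0 e0.
(* [stage] gives only [n <= M]; padding the block with zeros up to [M.+1] makes the ranks strictly
   increasing. *)
have weaken d : block n M c d -> block n M.+1 c d.
  move=> [nM c0 dc]; split=> //; first exact: leqW.
  move=> k /orP[kn|Mk]; apply: c0; first by rewrite kn.
  by rewrite (leq_trans _ Mk) ?orbT// leq_exp2l.
have MS x d : block n M c d -> wsum d (2 ^ M.+1) x = wsum d (2 ^ M) x.
  by move=> Bd; apply: (block_sum _ Bd); rewrite leq_exp2l.
have [d1 [B1 _ _]] := Hd (fun=> 1) (step_cst _ _) (fun=> mulr1 1).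
exists (M.+1, c, b); split=> /=.
- by split; [case: B1|exact: (weaken _ (block_c B1))].
- by split=> //; exact: step_le sb.
- rewrite (@eq_mean _ _ (fun x => `|wsum c (2 ^ M) x|)).
    by rewrite (le_trans mc)// ge_min lexx.
  by move=> x; rewrite (MS _ _ (block_c B1)).
- exact: mb.
- move=> sg ssg sg2; have [d [Bd dE dm]] := Hd sg ssg sg2.
  exists d; split; first exact: weaken.
    by move=> x; rewrite MS.
  move=> m; apply: (le_trans (dm m)).
  rewrite -[in leRHS](_ : 7 + 1 = 8 :> R) ?mulrDl ?mul1r ?lerD2l ?ge_min ?lexx ?orbT//.
  by ring.
Qed.

Lemma stages_exist : exists (n : nat -> nat) (c : nat -> nat -> R) (b : nat -> R -> R),
  n 0%N = 0%N /\ forall s, stage_spec (n s) (n s.+1) s (c s) (b s).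
Proof.
have [r rE] := choice (fun p : nat * nat => stage_exists p.1 p.2).
pose n := fix n s := if s is s'.+1 then (r (n s', s')).1.1 else 0%N.
exists n, (fun s => (r (n s, s)).1.2), (fun s => (r (n s, s)).2); split=> // s.
exact: rE (n s, s).
Qed.

Lemma L1_step N F : step N F -> L1 F = (mean (fun x => `|F x|))%:E.
Proof.
move=> sF; have := integrable_step (step_abs sF) => iF.
rewrite /mean /Rintegral fineK//; exact: (integrable_fin_num mU iF).
Qed.

Section Construction.
Variables (n : nat -> nat) (c : nat -> nat -> R) (b : nat -> R -> R).
Hypothesis n0 : n 0%N = 0%N.
Hypothesis Hst : forall s, stage_spec (n s) (n s.+1) s (c s) (b s).

Let nS s : (n s < n s.+1)%N. Proof. by case: (Hst s) => -[]. Qed.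
Let Bc s : block (n s) (n s.+1) (c s) (c s). Proof. by case: (Hst s) => -[]. Qed.
Let sb s : step (n s.+1) (b s). Proof. by case: (Hst s) => _ []. Qed.
Let b01 s x : b s x = 0 \/ b s x = 1. Proof. by case: (Hst s) => _ []. Qed.
Let ns s : (s <= n s)%N. Proof. exact: block_end_ge. Qed.
Let b_ge0 s x : 0 <= b s x. Proof. by case: (b01 s x) => ->. Qed.

Lemma coef_function : exists g : R -> R, in_L1 g /\ forall k, walsh_coef g k = total c k.
Proof.
pose F s x := wsum (c s) (2 ^ n s.+1) x.
have sF s : step (n s.+1) (F s) by exact: step_wsum.
have [|g [ig limg]] := @L1_series R F (fun s => measurable_step (sF s)).
  apply: le_lt_trans eseries_pow2; apply: lee_nneseries => s _ *.
    by apply: integral_ge0 => x _; rewrite lee_fin.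
  by rewrite (L1_step (sF s)) lee_fin; case: (Hst s).
exists g; split=> // k; apply: (@walsh_coef_lim _ (total c) (fun m => 2 ^ n m)%N) => //.
  by move=> m; exact: leq_trans (ns m) (ltnW (ltn_expl _ _)).
rewrite [X in X @ _](_ : _ = fun m => L1 (fun x => \sum_(0 <= s < m) F s x - g x)%R)//.
apply/funext => m; congr L1; apply/funext => x.
by rewrite (total_full n0 nS Bc).
Qed.

(** Where infinitely many [b s x] equal 1 the series diverges and [tsum] returns 0; by [ae_stakes]
    this concerns only a null set of points of [0, 1]. *)
Let T x := tsum (fun s => 2 ^+ s * b s x).

(* Small enough to absorb all the stakes lost at [x]: [T x * stage_weight x <= 1]. *)
Definition stage_weight x : R := expR (- T x).

Lemma stage_weight_gt0 x : 0 < stage_weight x.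
Proof. exact: expR_gt0. Qed.

Lemma stage_weight_le1 x : stage_weight x <= 1.
Proof.
rewrite -expR0 ler_expR oppr_le0; apply: tsum_ge0 => s.
by rewrite mulr_ge0 ?exprn_ge0.
Qed.

Lemma weight_function_stage_weight : weight_function stage_weight.
Proof.
split; last by move=> x _; rewrite stage_weight_gt0 stage_weight_le1.
have mT : leb_measurable_fun T.
  apply: measurable_tsum => [s|s x _]; first exact: (measurable_step (stepZ _ (sb s))).
  by rewrite mulr_ge0 ?exprn_ge0.
have mN : leb_measurable_fun (fun x => - T x) by exact: measurableT_comp.
exact: (measurableT_comp (@measurable_expR R) mN).
Qed.

(** Borel-Cantelli: the losing sets have measures [2 ^- s], of finite sum, so almost every point
    lies in finitely many of them and its stakes form a finite sum. *)
Lemma ae_stakes : {ae lambda, forall x : leb_line R, U x -> b ^~ x @ \oo --> 0 /\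
  forall m, (\sum_(0 <= s < m) 2 ^+ s * b s x) * stage_weight x <= 1}.
Proof.
have [|_ aeb] := @ae_summable R b (fun s => measurable_step (sb s)) (fun s x _ => b_ge0 s x).
  apply: le_lt_trans eseries_pow2; apply: lee_nneseries => s _ *.
    by apply: integral_ge0 => x _; rewrite lee_fin.
  rewrite (_ : (\int[lambda]_(x in U) _)%E = L1 (b s)).
    rewrite (L1_step (sb s)) lee_fin (@eq_mean _ _ (b s)); last by move=> x; rewrite ger0_norm.
    by case: (Hst s) => _ _ _ ->.
  by apply: eq_integral => x _; rewrite ger0_norm.
apply: aeS aeb => x h Ux; have {}h := h Ux.
have bx := summable_cvg0 (b_ge0 ^~ x) h; split=> // m.
have t0 s : 0 <= 2 ^+ s * b s x by rewrite mulr_ge0 ?exprn_ge0.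
have Too : (eseries (fun s => 2 ^+ s * b s x)%R < +oo)%E.
  have /cvgrPdist_lt/(_ _ ltr01)[s0 _ bs0] := bx.
  apply: (@eseries_bounded _ _ (\sum_(0 <= s < s0) 2 ^+ s * b s x)) => // k.
  have [ks|/ltnW sk] := leqP k s0.
    by rewrite [leRHS](@big_cat_nat _ _ _ k)//= lerDl sumr_ge0.
  rewrite (@big_cat_nat _ _ _ s0)//= [X in _ + X]big1_seq ?addr0// => s.
  rewrite mem_index_iota => /andP[_ /andP[/bs0 /=]].
  by rewrite sub0r normrN; case: (b01 s x) => ->; rewrite ?mulr0// normr1 ltxx.
(* What remains follows from [T x <= 1 + T x <= expR (T x)]. *)
rewrite /stage_weight expRN -ler_pdivlMr ?invr_gt0 ?expR_gt0// invrK mul1r.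
apply: (le_trans (sum_le_tsum m t0 Too)); apply: le_trans (expR_ge1Dx _).
by rewrite lerDr.
Qed.

Lemma L1_weight_le F : leb_measurable_fun F ->
  (\int[lambda]_(x in U) (`|F x| * stage_weight x)%:E <= L1 F)%E.
Proof.
move=> mF; have [mw _] := weight_function_stage_weight.
have mn : leb_measurable_fun (fun x => `|F x|) by exact: measurableT_comp.
apply: ge0_le_integral.
- exact: mU.
- by move=> x _; rewrite lee_fin mulr_ge0// ltW ?stage_weight_gt0.
- by apply/measurable_EFinP; exact: (measurable_funM mn mw).
- exact: measurable_normE.
- by move=> x _; rewrite lee_fin ler_piMr// stage_weight_le1.
Qed.

Lemma approximants f : in_weighted_L1 stage_weight f ->
  exists (phi : nat -> R -> R) (r : nat -> nat),
  [/\ r 0%N = 0%N, phi 0%N = (fun=> 0), forall k, step (r k) (phi k) &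
    (\sum_(0 <= k <oo) \int[lambda]_(x in U) (`|phi k x - f x| * stage_weight x)%:E < +oo)%E].
Proof.
move=> Hf; have [mf foo] := Hf; have wf := weight_function_stage_weight.
have e0 k : 0 < (2 ^- k : R) by rewrite invr_gt0 exprn_gt0.
have [p pE] := choice (fun k : nat => let: ex_intro N (ex_intro F H) :=
  weighted_step_dense wf Hf (e0 k) in ex_intro (fun q : nat * (R -> R) =>
   step q.1 q.2 /\ (\int[lambda]_(x in U) (`|f x - q.2 x| * stage_weight x)%:E < (2 ^- k)%:E)%E) (N, F) H).
(* The approximation starts from 0, of rank 0, so that the tracking begins without error and within
   the rank [n 0]; the first term of the series is then the weighted norm of [f]. *)
exists (fun k => if k is 0%N then fun=> 0 else (p k).2), (fun k => if k is 0%N then 0%N else (p k).1).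
split=> //; first by case=> [|k]; [exact: step_cst|case: (pE k.+1)].
pose A k : \bar R := (\int[lambda]_(x in U) (`|(if k is 0%N then fun=> 0 else (p k).2) x - f x| * stage_weight x)%:E)%E.
have A0 k : (0 <= A k)%E.
  by apply: integral_ge0 => x _; rewrite lee_fin mulr_ge0// ltW ?stage_weight_gt0.
rewrite [X in (X < _)%E](_ : _ = (\sum_(0 <= k <oo) A k)%E)//.
rewrite (@nneseries_recl _ xpredT)// lte_add_pinfty//.
  rewrite /A; under eq_integral do rewrite sub0r normrN.
  exact: foo.
rewrite -nneseries_addn//; apply: le_lt_trans eseries_pow2.
apply: lee_nneseries => // k _; rewrite addn1 /A.
under eq_integral do rewrite distrC.
apply: ltW; case: (pE k.+1) => _ /lt_le_trans; apply.
by rewrite lee_fin lef_pV2 ?posrE ?exprn_gt0// exprS ler_peMl ?exprn_ge0// ler1n.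
Qed.

Lemma signs_for f : in_weighted_L1 stage_weight f -> exists d : nat -> nat -> R,
  [/\ forall s, block (n s) (n s.+1) (c s) (d s),
      forall s m, mean (fun x => `|wsum (d s) m x|) <= 8 * @harmonic R s &
      (\int[lambda]_(x in U)
         (`|wsum (total d) (2 ^ n s) x - f x| * stage_weight x)%:E)%E @[s --> \oo] --> 0%E].
Proof.
move=> Hf; have [mf _] := Hf; have [phi [r [r0 phi0 sphi phioo]]] := approximants Hf.
have [mw _] := weight_function_stage_weight.
pose kk := slow_index r n.
(* The partial sums at the block ends are foretold before the coefficients are chosen: the sign of
   stage [s] depends only on [S s] and the current approximant, both steps of rank [n s], hence is
   admissible for the stage. [totS] confirms the prediction. *)
pose S := fix S s x : R := if s is s'.+1 then
  S s' x + steer_sign (S s' x) (phi (kk s') x) * @harmonic R s' * (1 - 2 ^+ s' * b s' x)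
  else 0.
pose sg s x := steer_sign (S s x) (phi (kk s) x).
have sphik s : step (n s) (phi (kk s)).
  by apply: step_le (sphi _); apply: slow_index_rank => // i; exact: ltnW.
have sS s : step (n s) (S s).
  elim: s => [|s IH]; first exact: step_cst.
  have le_s := ltnW (nS s).
  have s1 := step_comp2 (fun u v => steer_sign u v * @harmonic R s) IH (sphik s).
  have s2 := stepB (step_cst (n s.+1) 1) (stepZ (2 ^+ s) (sb s)).
  exact: (stepD (step_le le_s IH) (stepM (step_le le_s s1) s2)).
have ssg s : step (n s) (sg s) by exact: step_comp2 (sS s) (sphik s).
have dex s : exists d, [/\ block (n s) (n s.+1) (c s) d,
    forall x, wsum d (2 ^ n s.+1) x = sg s x * @harmonic R s * (1 - 2 ^+ s * b s x) &
    forall m, mean (fun x => `|wsum d m x|) <= 8 * @harmonic R s].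
  by case: (Hst s) => _ _ _ _ H; apply: H => // x; exact: steer_sign_sq.
have [d dE] := choice dex; exists d.
have Bd s : block (n s) (n s.+1) (c s) (d s) by case: (dE s).
split=> //; first by move=> s; case: (dE s).
have totS s x : wsum (total d) (2 ^ n s) x = S s x.
  rewrite (total_full n0 nS Bd); elim: s => [|s IH]; first by rewrite big_geq.
  by rewrite big_nat_recr//= IH; case: (dE s) => _ ->.
pose a k x := `|phi k x - f x| * stage_weight x.
have a0 k x : 0 <= a k x by rewrite mulr_ge0// ltW ?stage_weight_gt0.
have mdiff F : leb_measurable_fun F ->
    leb_measurable_fun (fun x => `|F x - f x| * stage_weight x).
  move=> mF; have mD : leb_measurable_fun (fun x => `|F x - f x|).
    by apply: measurableT_comp; [|exact: measurable_fun_sub].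
  exact: (measurable_funM mD mw).
have ma k : leb_measurable_fun (a k) by apply: mdiff; exact: measurable_step (sphi k).
have [iV aeV] := ae_summable ma (fun k x _ => a0 k x) phioo.
pose w x k := `|phi k x - f x|.
have wpart x m : (eseries (a ^~ x) < +oo)%E ->
    \sum_(0 <= k < m) w x k <= (stage_weight x)^-1 * tsum (a ^~ x).
  move=> aoo; have mi0 : 0 <= (stage_weight x)^-1 by rewrite invr_ge0 ltW ?stage_weight_gt0.
  apply: le_trans (ler_wpM2l mi0 (sum_le_tsum m (a0 ^~ x) aoo)).
  rewrite mulr_sumr le_eqVlt; apply/orP; left; apply/eqP; apply: eq_bigr => k _.
  by rewrite /a mulrCA mulVf ?mulr1// gt_eqF ?stage_weight_gt0.
have w0 x k : 0 <= w x k by exact: normr_ge0.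
have aegood := aeI aeV ae_stakes.
(* In the dominating function, 2 bounds the weight plus the weighted stakes, each at most 1. The
   other term comes from [3 * tsum (w x)]: dividing [a] by the positive weight shows that [w x] is
   summable wherever [a] is. *)
have [|||||_ _ +] := @dominated_convergence _ _ _ lambda U mU
    (fun s x => (`|S s x - f x| * stage_weight x)%:E) (cst 0%E)
    (fun x => (2 + 3 * tsum (a ^~ x))%:E).
- by move=> s; apply/measurable_EFinP; apply: mdiff; exact: measurable_step (sS s).
- exact: measurable_cst.
- apply: aeS aegood => x [aoo stx] Ux; have {}aoo := aoo Ux; have [bx _] := stx Ux.
  have woo := eseries_bounded (w0 x) (fun m => wpart x m aoo).
  have Sx : S ^~ x @ \oo --> f x.
    by apply: (@track_cvg _ (S ^~ x) (b ^~ x) (phi ^~ x) (f x) r n).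
  have Dx : `|S s x - f x| * stage_weight x @[s --> \oo] --> 0.
    rewrite -[X in _ --> X](mul0r (stage_weight x)) -(normr0 R) -(subrr (f x)).
    apply: cvgM; last exact: cvg_cst.
    by apply: cvg_norm; apply: cvgB; [exact: Sx|exact: cvg_cst].
  by apply/fine_cvgP; split; [exact: nearW|exact: Dx].
- have := integrableD mU (integrable_step (step_cst 0 2)) (integrableZl mU 3 iV).
  by apply: eq_integrable => //; exact: mU.
- apply: aeS aegood => x [aoo stx] s Ux; have {}aoo := aoo Ux; have [_ bx] := stx Ux.
  have woo := eseries_bounded (w0 x) (fun m => wpart x m aoo).
  have wt := tsum_le_bound (w0 x) (fun m => wpart x m aoo).
  have mu0 := stage_weight_gt0 x.
  rewrite lee_fin ger0_norm; last by rewrite mulr_ge0// ltW.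
  have tb : `|S s x - f x| <= 1 + \sum_(0 <= j < s) 2 ^+ j * b j x + 3 * tsum (w x).
    by apply: (@track_bound _ (S ^~ x) (b ^~ x) (phi ^~ x) (f x) r n); rewrite ?phi0.
  apply: (le_trans (ler_wpM2r (ltW mu0) tb)).
  have {}wt : tsum (w x) * stage_weight x <= tsum (a ^~ x).
    by rewrite -ler_pdivlMr// mulrC.
  have := bx s; have := stage_weight_le1 x; set X := \sum_(_ <= _ < _) _ => h1 h2.
  rewrite [leLHS](_ : _ = stage_weight x + X * stage_weight x +
    3 * (tsum (w x) * stage_weight x)); last by ring.
  by lra.
rewrite integral0 (_ : (fun s => _) = (fun s =>
  \int[lambda]_(x in U) (`|wsum (total d) (2 ^ n s) x - f x| * stage_weight x)%:E)%E)//.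
by apply/funext => s; apply: eq_integral => x _; rewrite totS.
Qed.

(** Equal absolute values leave only a sign; for a vanishing coefficient the test succeeds and the
    sign is 1. *)
Lemma total_sign d k : (forall s, block (n s) (n s.+1) (c s) (d s)) ->
  (if total d k == total c k then 1 else -1) * total c k = total d k.
Proof.
move=> Bd; have : `|total d k| = `|total c k|.
  have [->|k0] := posnP k; first by rewrite (total0 n0 Bd) (total0 n0 Bc).
  have [s sk] := find_block n0 nS k0.
  by rewrite (total_block nS Bd sk) (total_block nS Bc sk); case: (Bd s).
case: eqP => [->|ne]; first by rewrite mul1r.
rewrite mulN1r => /eqP; rewrite eqr_norm2 => /orP[/eqP//|/eqP ->//].
Qed.

(** From the block ends to all partial sums: a sum cut inside the block [s] adds a partial sum of
    [d s], whose mean absolute value is at most [8 * harmonic s], and the weight is at most 1. *)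
Lemma universal_stage_weight g : (forall k, walsh_coef g k = total c k) ->
  universal_wrt_signs stage_weight g.
Proof.
move=> gc f Hf; have [mf _] := Hf; have [d [Bd dm Slim]] := signs_for Hf.
have [mw _] := weight_function_stage_weight.
exists (fun k => if total d k == total c k then 1 else -1); split.
  by move=> k; case: ifP => _; [right|left].
have mint F : leb_measurable_fun F ->
    measurable_fun U (fun x : leb_line R => (`|F x| * stage_weight x)%:E).
  move=> mF; have mD : leb_measurable_fun (fun x => `|F x|) by exact: measurableT_comp.
  by apply/measurable_EFinP; exact: (measurable_funM mD mw).
have mwsum m : leb_measurable_fun (wsum (total d) m).
  by apply: (@measurable_step _ m); apply: step_wsum; exact: ltnW (ltn_expl _ _).
pose v m := (\int[lambda]_(x in U) (`|wsum (total d) m.+1 x - f x| * stage_weight x)%:E)%E.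
have wxE m x : (forall k, walsh k x = wal k x) ->
    \sum_(0 <= k < m) (if total d k == total c k then 1 else -1) * walsh_coef g k * walsh k x =
    wsum (total d) m x.
  by move=> wx; apply: eq_bigr => k _; rewrite gc total_sign// wx.
rewrite [X in X @ _](_ : _ = v); last first.
  apply/funext => m; apply: ae_eq_integral; first exact: mU.
  - apply: mint; apply: measurable_fun_sub mf; apply: ae_leb_measurable (mwsum m.+1).
    by apply: aeS walsh_ae => x wx Ux; rewrite wxE//; exact: wx.
  - exact: mint (measurable_fun_sub (mwsum m.+1) mf).
  - apply: aeS walsh_ae => x wx Ux; rewrite wxE//; exact: wx.
(* The sum over [k <= m] has [m.+1] terms, so the block is located from [m.+1], which is moreover
   positive as [find_block] requires. *)
have [s sE] := choice (fun m => find_block n0 nS (ltn0Sn m)).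
pose A s := (\int[lambda]_(x in U)
  (`|wsum (total d) (2 ^ n s) x - f x| * stage_weight x)%:E)%E.
have Alim : (fun s => (A s + (8 * @harmonic R s)%:E)%E) @ \oo --> 0%E.
  rewrite -[X in _ --> X]adde0; apply: cvgeD => //.
  apply/fine_cvgP; split; first exact: nearW.
  rewrite -(mulr0 8); apply: cvgMr; exact: cvg_harmonic.
have s_oo : s @ \oo --> \oo.
  apply/cvgnyPge => K; exists (2 ^ n K)%N => // m /= Km.
  have /andP[_ ms] := sE m.
  have := leq_ltn_trans (leqW Km) ms; rewrite ltn_exp2l// => Ks.
  rewrite leqNgt; apply/negP => sK; move: Ks; rewrite ltnNge.
  by rewrite (block_end_le nS sK).
apply: (@squeeze_cvge _ _ _ _ (cst 0%E) _ (fun m => (A (s m) + (8 * @harmonic R (s m))%:E)%E)).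
- apply: nearW => m; apply/andP; split.
    by apply: integral_ge0 => x _; rewrite lee_fin mulr_ge0// ltW ?stage_weight_gt0.
  have /andP[s1 s2] := sE m.
  have smE : (2 ^ n (s m) <= m.+1 <= 2 ^ n (s m).+1)%N by rewrite s1 ltnW.
  pose D := wsum (d (s m)) m.+1.
  have sD : step (n (s m).+1) D by apply: step_wsum; exact: ltnW.
  apply: (@le_trans _ _ (A (s m) + \int[lambda]_(x in U) (`|D x| * stage_weight x)%:E)%E).
    have mA := mint _ (measurable_fun_sub (mwsum (2 ^ n (s m))%N) mf).
    have mD := mint _ (measurable_step sD).
    have p0 F (x : leb_line R) : U x -> (0 <= (`|F x| * stage_weight x)%:E)%E.
      by move=> _; rewrite lee_fin mulr_ge0// ltW ?stage_weight_gt0.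
    rewrite /A -(ge0_integralD _ mU (p0 _) mA (p0 _) mD).
    apply: ge0_le_integral.
    - exact: mU.
    - exact: p0.
    - exact: mint (measurable_fun_sub (mwsum m.+1) mf).
    - exact: emeasurable_funD.
    - move=> x _; rewrite -EFinD lee_fin -mulrDl.
      apply: ler_wpM2r; first exact: ltW (stage_weight_gt0 x).
      rewrite (total_partial nS Bd x smE) -/(D x) addrAC.
      exact: ler_normD.
  apply: leeD => //; apply: (le_trans (L1_weight_le (measurable_step sD))).
  by rewrite (L1_step sD) lee_fin; exact: dm.
- exact: cvg_cst.
- exact: cvg_comp s_oo Alim.
Qed.

End Construction.
End Universality.

Theorem mainTheorem1 (R : realType) :
  exists g mu : R -> R,
    [/\ in_L1 g, weight_function mu & universal_wrt_signs mu g].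
Proof.
have [n [c [b [n0 Hst]]]] := @stages_exist R.
have [g [ig gc]] := coef_function n0 Hst.
exists g, (stage_weight b); split=> //.
- exact: (weight_function_stage_weight Hst).
- exact: (universal_stage_weight n0 Hst gc).
Qed.
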